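(* Let $r\ge2$ and let $B^\vee D^\vee$ be the symmetric $r\times r$ matrix whose $(1,1)$ entry is $1$, $(1,r)$ and $(r,1)$ entries are $1$, $(1,j)$ and $(j,1)$ entries are $0$ for $2\le j\le r-1$, $(i,j)$ entry is $2(\min(i,j)-1)$ for $2\le i,j\le r$ with $(i,j)\ne(r,r)$, and $(r,r)$ entry is $2r-1$. (1) With $\boldsymbol b_0=(1,1,2,3,\ldots,r-1)^T$ (first entry $1$, $i$-th entry $i-1$ for $2\le i\le r$), $$\sum_{\boldsymbol n=(n_1,\ldots,n_r)^T\in\mathbb{N}^r}\frac{(-1)^{n_r}q^{\frac12\boldsymbol n^TB^\vee D^\vee\boldsymbol n+\boldsymbol n^T\boldsymbol b_0}}{(q;q)_{n_1}\cdots(q;q)_{n_{r-1}}(q^2;q^2)_{n_r}}=\frac{(q^{\frac12},q^{2r-2},q^{2r-\frac32};q^{2r-\frac32})_\infty}{(q^{\frac12},q^{\frac32},q^2;q^2)_\infty}.$$ (2) For $1\le j\le r$, with $\boldsymbol b_j=(0,\ldots,0,1,2,\ldots,r-j-1,r-j-1)^T$ ($i$-th entry $\max(i-j,0)$ for $1\le i\le r-1$, last entry $r-j-1$), $$\sum_{\boldsymbol n=(n_1,\ldots,n_r)^T\in\mathbb{N}^r}\frac{(-1)^{n_r}q^{\frac12\boldsymbol n^TB^\vee D^\vee\boldsymbol n+\boldsymbol n^T\boldsymbol b_j}}{(q;q)_{n_1}\cdots(q;q)_{n_{r-1}}(q^2;q^2)_{n_r}}=\frac{(q^j,q^{2r-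j-\frac32},q^{2r-\frac32};q^{2r-\frac32})_\infty}{(q^{\frac12},q^{\frac32},q^2;q^2)_\infty}.$$
   Context: Here $q=e^{2\pi i\tau}$ with $\mathrm{Im}\,\tau>0$, $q^x=e^{2\pi ix\tau}$ for rational $x$; $\mathbb{N}=\{0,1,2,\ldots\}$; $(a;p)_\infty=\prod_{n\ge0}(1-ap^n)$, $(a;p)_n=\prod_{k=0}^{n-1}(1-ap^k)$, $(a_1,\ldots,a_k;p)_\infty=\prod_i(a_i;p)_\infty$ for $|p|<1$. *)

(* Defs.v *)
From HB Require Import structures.
From mathcomp Require Import all_boot all_order all_algebra complex finmap.
From mathcomp Require Import boolp classical_sets reals topology normedtype.
From mathcomp Require Import sequences exp trigo.
From mathcomp.analysis.showcase Require Import summability.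

Set Implicit Arguments.
Unset Strict Implicit.
Unset Printing Implicit Defensive.

Import Order.TTheory GRing.Theory Num.Theory.
Import numFieldNormedType.Exports.

Local Open Scope classical_set_scope.
Local Open Scope complex_scope.
Local Open Scope ring_scope.

(* The topology of the norm on [R[i]], which the library provides for the
   regular module [R[i]^o]. *)
HB.instance Definition _ (R : realType) := NormedModule.copy R[i] R[i]^o.

Section QSeries.
Variable R : realType.
Local Notation C := R[i].

Definition cexp (z : C) : C :=
  (expR (complex.Re z))%:C * (cos (complex.Im z) +i* sin (complex.Im z)).

(* q^x = e^(2 pi i x tau); in particular q = qpow tau 1. *)
Definition qpow (tau : C) (x : rat) : C :=
  cexp ((0 +i* (2 * pi)) * ratr x * tau).

Definition qpoch (a p : C) (n : nat) : C := \prod_(k < n) (1 - a * p ^+ k).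

(* The limit of the partial products, which exists whenever |p| < 1. *)
Definition qpoch_inf (a p : C) : C := lim (qpoch a p n @[n --> \oo]).

Definition qpochs_inf (s : seq C) (p : C) : C := \prod_(a <- s) qpoch_inf a p.

(* Unordered convergence: the sums over finite
   sets of indices, directed by inclusion, converge to [s]. In [C] this is
   the same as absolute convergence with sum [s]. *)
Definition has_sum (I : choiceType) (f : I -> C) (s : C) : Prop :=
  partial_sum f A @[A --> totally] --> s.

End QSeries.

(* Row, column and vector indices are shifted by one: [i : 'I_r] stands for
   the 1-based index [i.+1]. *)
Definition BDmx (r : nat) : 'M[rat]_r :=
  \matrix_(i < r, j < r)
    let i1 := i.+1 in let j1 := j.+1 in
    if (i1 == r)%N && (j1 == r)%N then 2 * r%:R - 1
    else if (1 < i1)%N && (1 < j1)%N then 2 * ((minn i1 j1)%:R - 1)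
    else if (i1 == 1)%N && (j1 == 1)%N then 1
    else if (i1 == 1)%N && (j1 == r)%N || (i1 == r)%N && (j1 == 1)%N then 1
    else 0.

Definition b0vec (r : nat) : 'cV[rat]_r :=
  \col_(i < r) if (i.+1 == 1)%N then 1 else i.+1%:R - 1.

(* The last entry can be negative: it is -1 for j = r. *)
Definition bvec (r j : nat) : 'cV[rat]_r :=
  \col_(i < r) if i.+1 == r then r%:R - j%:R - 1
               else Num.max (i.+1%:R - j%:R) 0.

Definition qexponent (r : nat) (b : 'cV[rat]_r) (n : 'cV[nat]_r) : rat :=
  let N : 'cV[rat]_r := map_mx (fun k : nat => k%:R) n in
  (2^-1 *: (N^T *m BDmx r *m N) + N^T *m b) 0 0.

(* The sum has a single term, so this is n_r. *)
Definition last_entry (r : nat) (n : 'cV[nat]_r) : nat :=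
  (\sum_(i < r | i.+1 == r) n i ord0)%N.

Definition summand (R : realType) (tau : R[i]) (r : nat) (b : 'cV[rat]_r)
    (n : 'cV[nat]_r) : R[i] :=
  let q := qpow tau 1 in
  (-1) ^+ last_entry n * qpow tau (qexponent b n) /
  ((\prod_(i < r | (i.+1 < r)%N) qpoch q q (n i 0)) *
   qpoch (q ^+ 2) (q ^+ 2) (last_entry n)).

(* Main.v *)
(* With p = q^(1/2) and N_k = n_{k+1} + ... + n_r, the exponent of q is
   (n_1 + n_r)^2/2 + b n_1 - (1-b) n_r + sum_{1<=k<r} (N_k^2 + [k >= j] N_k),
   where b = j = 1 in part (1) and b = 0 in part (2).  The sum over n_1 is
   Euler's and gives (-p^(1+2b); q)_oo / (-p^(1+2b); q)_{n_r}.  What remains is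
   an iterated Bailey chain, built on a Bailey pair relative to a = q whose
   bilateral alpha is (-1)^m p^(m(m-1)/2 - (1-b) m): the r-j innermost steps are
   taken with a = q, then the same alpha is reread relative to a = 1, and the
   j-1 outer steps are taken with a = 1.  The resulting theta series is
   evaluated by the Jacobi triple product.

   All of this is done with finite sums, by cutting off with 1/(q;q)_{N-N_1} and
   (q;q)_{N-n_r}/(q;q)_{N-n_r-n_1}.  Dominated convergence as N tends to
   infinity gives the theorem, and also the triple product from its finite
   form. *)
Require Import Defs.
From mathcomp Require Import all_boot all_order all_algebra complex reals.
From mathcomp Require Import finmap boolp classical_sets topology normedtype.
From mathcomp Require Import sequences exp trigo ring lra zify.
From mathcomp.analysis.showcase Require Import summability.

Set Implicit Arguments.
Unset Strict Implicit.
Unset Printing Implicit Defensive.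

Import Order.TTheory GRing.Theory Num.Theory.
Import numFieldNormedType.Exports.

Local Open Scope ring_scope.
Local Open Scope classical_set_scope.
Local Open Scope complex_scope.

#[local] Existing Instance totally_filter.

(** * Unordered sums and dominated convergence *)

(** The Bailey pair calls for the sums [sum_k (-x)^k p^(k(k-1)/2) / ((q)_k (q)_(L-k))], in base [p]
    instead of [q], so the q-binomial theorem does not evaluate them. At the few points [x] that
    occur, close to the fixed point of the reversal [k -> L-k], recurrences do. The factors
    [1 + p^(2n+1)] and [1 - p^(4n+4)] met on the way build the beta denominators: [(-p;q)_n], which
    cancels against what Euler's sum over [n_1] leaves, and [(q^2;q^2)_n], which is the one attached
    to [n_r].

    Rereading alpha relative to [a = 1] rests on [alpha(-1-m) = -q^(2m+1) alpha(m)]. This holds for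
    [b = 0] and fails for [b = 1], but part (1) takes all its steps with [a = q].

    The cut-off in [n_1] is chosen so that the finite Euler sum equals [(x;q)_N / (x;q)_(n_r)] with
    [x = -p^(1+2b)]: its dependence on [N] is a scalar that leaves the chain, and the Bailey steps
    then apply at each finite [N]. *)

Section Summation.
Variable R : realType.
Local Notation C := R[i].

Lemma partial_sumE (I : choiceType) (V : zmodType) (f : I -> V) (A : {fset I}) :
  partial_sum f A = \sum_(i <- A) f i.
Proof. by rewrite /partial_sum big_seq_fsetE. Qed.

Lemma big_fsetUD (I : choiceType) (V : zmodType) (f : I -> V) (A B : {fset I}) :
  \sum_(i <- (A `|` B)%fset) f i =
  \sum_(i <- A) f i + \sum_(i <- (B `\` A)%fset) f i.
Proof.
rewrite (big_fsetID _ (mem A)) /=; congr (_ + _); apply: perm_big;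
  apply: uniq_perm; rewrite ?fset_uniq // => i; rewrite !inE /=;
  by case: (i \in A); rewrite ?andbF ?andbT.
Qed.

Lemma has_sumP (I : choiceType) (f : I -> C) (s : C) :
  has_sum f s <-> (forall e : R, 0 < e -> exists A0 : {fset I},
    forall A : {fset I}, (A0 `<=` A)%fset -> `|s - \sum_(i <- A) f i| < e%:C).
Proof.
split=> [fs e e0|fs].
  have e0' : (0 : C) < e%:C by rewrite ltcR.
  move/cvgrPdist_lt : fs => /(_ _ e0') [A0 _ A0P].
  by exists A0 => A AA0; rewrite -partial_sumE; exact: A0P.
apply/cvgrPdist_lt => e e0.
have eE : e = (complex.Re e)%:C by rewrite RRe_real// ger0_real// ltW.
have [|A0 A0P] := fs (complex.Re e); first by rewrite -ltcR -eE.
by exists A0 => // A /= AA0; rewrite partial_sumE eE; exact: A0P.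
Qed.

Lemma has_sum_finite (I : choiceType) (f : I -> C) (s : seq I) :
  uniq s -> (forall i, i \notin s -> f i = 0) ->
  has_sum f (\sum_(i <- s) f i).
Proof.
move=> us fs; apply/has_sumP => e e0; exists [fset i in s]%fset => A sA.
have -> : \sum_(i <- s) f i = \sum_(i <- [fset i in s]%fset) f i.
  by apply: perm_big; apply: uniq_perm => // i; rewrite !inE.
rewrite (big_fset_incl _ sA) ?subrr ?normr0 ?ltcR// => i _.
by rewrite inE => /fs.
Qed.

Lemma has_sum_unique (I : choiceType) (f : I -> C) (s t : C) :
  has_sum f s -> has_sum f t -> s = t.
Proof. exact: cvg_unique. Qed.

Lemma has_sum_eq (I : choiceType) (f g : I -> C) (s : C) :
  has_sum f s -> f =1 g -> has_sum g s.
Proof. by move=> fs /funext <-. Qed.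

Lemma has_sumD (I : choiceType) (f g : I -> C) (s t : C) :
  has_sum f s -> has_sum g t -> has_sum (fun i => f i + g i) (s + t).
Proof.
move=> fs gt; rewrite /has_sum.
rewrite [X in X @ _ --> _](_ : _ =
    (fun A => partial_sum f A + partial_sum g A)); last first.
  by apply/funext => A; rewrite /partial_sum big_split.
exact: (cvgD fs gt).
Qed.

Lemma has_sumZ (I : choiceType) (f : I -> C) (c s : C) :
  has_sum f s -> has_sum (fun i => c * f i) (c * s).
Proof.
move=> fs; rewrite /has_sum.
rewrite [X in X @ _ --> _](_ : _ = (fun A => c * partial_sum f A)); last first.
  by apply/funext => A; rewrite /partial_sum mulr_sumr.
exact: (cvgM (cvg_cst c) fs).
Qed.

Lemma has_sum_sum (I : choiceType) (J : Type) (r : seq J) (f : J -> I -> C)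
    (s : J -> C) :
  (forall j, has_sum (f j) (s j)) ->
  has_sum (fun i => \sum_(j <- r) f j i) (\sum_(j <- r) s j).
Proof.
move=> fs; elim: r => [|j r IH].
  have := @has_sum_finite I (fun=> 0) [::] isT (fun _ _ => erefl).
  by rewrite !big_nil => /has_sum_eq; apply=> i; rewrite big_nil.
by rewrite big_cons; apply: (has_sum_eq (has_sumD (fs j) IH)) => i;
  rewrite big_cons.
Qed.

Lemma has_sum_reindex (I : choiceType) (h h' : I -> I) (f : I -> C) (s : C) :
  cancel h h' -> cancel h' h -> has_sum f s -> has_sum (f \o h) s.
Proof.
move=> hK h'K /has_sumP fs; apply/has_sumP => e /fs[A0 A0P].
exists (h' @` A0)%fset => A A0A.
have -> : \sum_(i <- A) (f \o h) i = \sum_(i <- (h @` A)%fset) f i.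
  rewrite big_imfset//=; exact: in2W (can_inj hK).
apply: A0P; apply/fsubsetP => i iA0; apply/imfsetP; exists (h' i) => //=.
by move/fsubsetP: A0A; apply; apply/imfsetP; exists i.
Qed.

Lemma has_sum_antisym (I : choiceType) (h : I -> I) (f : I -> C) (s : C) :
  involutive h -> (forall i, f (h i) = - f i) -> has_sum f s -> s = 0.
Proof.
move=> hK fN fs; have fs' := has_sum_reindex hK hK fs.
have /(has_sum_unique fs') : has_sum (f \o h) (- s).
  by rewrite -mulN1r; apply: (has_sum_eq (has_sumZ (c := -1) fs)) => i /=;
    rewrite fN mulN1r.
by move/eqP; rewrite -addr_eq0 -mulr2n mulrn_eq0 /= => /eqP.
Qed.

Section Dominated.
Variables (I : choiceType) (g : I -> R) (M : R).
Hypothesis gM : forall A : {fset I}, \sum_(i <- A) g i <= M.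

(** Any [A0] whose sum is within [e] of the supremum of all finite sums will do: nothing disjoint
    from it can add [e] or more. *)
Lemma bounded_sum_tail (e : R) : 0 < e -> exists A0 : {fset I},
  forall A : {fset I}, (A0 `<=` A)%fset ->
    \sum_(i <- (A `\` A0)%fset) g i < e.
Proof.
move=> e0; pose S := [set \sum_(i <- A) g i | A in [set: {fset I}]].
have hS : has_sup S.
  split; first by exists (\sum_(i <- fset0) g i); exists fset0.
  by exists M => _ [A _ <-].
have [_ [A0 _ <-] SA0] := sup_adherent e0 hS.
exists A0 => A A0A.
have : \sum_(i <- A) g i <= sup S.
  by apply: ub_le_sup; [exact: hS.2|exists A].
have -> : A = (A0 `|` A)%fset by apply/esym/fsetUidPr.
rewrite big_fsetUD.
have -> : ((A0 `|` A) `\` A0 = A `\` A0)%fset.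
  by rewrite fsetDUl fsetDv fset0U.
lra.
Qed.

Variables (F : nat -> I -> C) (f : I -> C) (s_ : nat -> C).
Hypothesis Fg : forall N i, `|F N i| <= (g i)%:C.
Hypothesis Ff : forall i, F N i @[N --> \oo] --> f i.
Hypothesis Fs : forall N, has_sum (F N) (s_ N).

(** The set [A0] depends on the majorant [g] only, hence not on [N]. For a given [N], a set [B] that
    is good for [F N] is added to [A]; the new indices avoid [A0] and cost less than [e / 2]. *)
Let uniform_tail (e : R) : 0 < e -> exists A0 : {fset I},
  forall A : {fset I}, (A0 `<=` A)%fset ->
  forall N, `|s_ N - \sum_(i <- A) F N i| < e%:C.
Proof.
move=> e0; have e2 : 0 < e / 2 by rewrite divr_gt0.
have [A0 A0P] := bounded_sum_tail e2.
exists A0 => A A0A N.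
have /has_sumP/(_ _ e2)[B BP] := @Fs N.
have := BP (A `|` B)%fset (fsubsetUr _ _).
rewrite big_fsetUD => h.
have -> : s_ N - \sum_(i <- A) F N i =
    s_ N - (\sum_(i <- A) F N i + \sum_(i <- (B `\` A)%fset) F N i) +
    \sum_(i <- (B `\` A)%fset) F N i by ring.
have -> : e%:C = (e / 2)%:C + (e / 2)%:C by rewrite -rmorphD -splitr.
apply: le_lt_trans (ler_normD _ _) _; apply: ltr_leD => //.
apply: le_trans (ler_norm_sum _ _ _) _.
apply: le_trans (ler_sum _ (fun i _ => Fg N i)) _.
rewrite -rmorph_sum lecR.
have g0 i : 0 <= g i.
  by rewrite -lecR; apply: le_trans (Fg 0 i); exact: normr_ge0.
have := A0P _ (fsubset_trans A0A (fsubsetUl A B)).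
move/ltW; apply: le_trans.
have sub : (B `\` A `<=` (A `|` B) `\` A0)%fset.
  apply/fsubsetP => i; rewrite !inE => /andP[iA ->]; rewrite orbT andbT.
  by apply: contra iA => /(fsubsetP A0A).
rewrite -(fsetUidPr _ _ sub) big_fsetUD lerDl.
by apply: sumr_ge0.
Qed.

Let cvg_partial (A : {fset I}) :
  \sum_(i <- A) F N i @[N --> \oo] --> \sum_(i <- A) f i.
Proof.
apply: (@cvg_big C I +%R 0 xpredT) => [|i _]; last exact: Ff.
exact: add_continuous.
Qed.

Let split3 (e : R) : e%:C = (e / 3)%:C + (e / 3)%:C + (e / 3)%:C.
Proof. by rewrite -!rmorphD /=; congr _%:C; field. Qed.

Lemma dominated_has_sum (s : C) : s_ N @[N --> \oo] --> s -> has_sum f s.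
Proof.
move=> ss; apply/has_sumP => e e0; have e3 : 0 < e / 3 by rewrite divr_gt0.
have e3C : (0 : C) < (e / 3)%:C by rewrite ltcR.
have [A0 A0P] := uniform_tail e3; exists A0 => A A0A.
move/cvgrPdist_lt : (ss) => /(_ _ e3C) s1.
move/cvgrPdist_lt : (@cvg_partial A) => /(_ _ e3C) s2.
have [N [sN fN]] := filter_ex (filterI s1 s2).
rewrite (_ : s - _ = (s - s_ N) + (s_ N - \sum_(i <- A) F N i) -
  (\sum_(i <- A) f i - \sum_(i <- A) F N i)); last by ring.
rewrite split3; apply: le_lt_trans (ler_normB _ _) _; apply: ltrD => //.
by apply: le_lt_trans (ler_normD _ _) _; apply: ltrD => //; exact: A0P.
Qed.

(** The counterpart of [dominated_has_sum]: here the sum of the limit terms is known and the limit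
    of the totals is deduced. The Bailey pairs use this direction; the triple product and the final
    multisum use the other. *)
Lemma dominated_cvg (s : C) : has_sum f s -> s_ N @[N --> \oo] --> s.
Proof.
move=> /has_sumP fs; apply/cvgrPdist_lt => e' e'0.
have eE : e' = (complex.Re e')%:C by rewrite RRe_real// ger0_real// ltW.
move: e'0; rewrite eE ltcR; move: (complex.Re e') => e e0 {e' eE}.
have e3 : 0 < e / 3 by rewrite divr_gt0.
have e3C : (0 : C) < (e / 3)%:C by rewrite ltcR.
have [A0 A0P] := uniform_tail e3; have [A1 A1P] := fs _ e3.
pose A := (A0 `|` A1)%fset.
move/cvgrPdist_lt : (@cvg_partial A) => /(_ _ e3C).
apply: filterS => N fN.
rewrite (_ : s - _ = (s - \sum_(i <- A) f i) +
  (\sum_(i <- A) f i - \sum_(i <- A) F N i) -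
  (s_ N - \sum_(i <- A) F N i)); last by ring.
rewrite split3; apply: le_lt_trans (ler_normB _ _) _; apply: ltrD => //.
  apply: le_lt_trans (ler_normD _ _) _; apply: ltrD => //.
  exact/A1P/fsubsetUr.
exact/A0P/fsubsetUl.
Qed.

End Dominated.

End Summation.

(** * Convergence of infinite products *)

Section Products.
Variable R : realType.
Local Notation C := R[i].

Lemma geometric_bound (rho : R) (n : nat) : 0 <= rho < 1 ->
  \sum_(k < n) rho ^+ k <= (1 - rho)^-1.
Proof.
move=> /andP[rho0 rho1]; have rho1' : 0 < 1 - rho by rewrite subr_gt0.
rewrite -div1r ler_pdivlMr// mulrC -opprB mulNr -subrX1 opprB.
by rewrite gerBl exprn_ge0.
Qed.

Lemma prod_geometric_bound (y : nat -> C) (K rho : R) (n : nat) :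
  0 <= rho < 1 -> (forall k, `|y k| <= (K * rho ^+ k)%:C) ->
  `|\prod_(k < n) (1 + y k)| <= (expR (K * (1 - rho)^-1))%:C.
Proof.
move=> rho01 yK.
have K0 : 0 <= K.
  by have := le_trans (normr_ge0 _) (yK 0); rewrite expr0 mulr1 lecR.
apply: (@le_trans _ _ (\prod_(k < n) expR (K * rho ^+ k))%:C); last first.
  by rewrite lecR -expR_sum ler_expR -mulr_sumr ler_wpM2l// geometric_bound.
rewrite normr_prod rmorph_prod; apply: ler_prod => k _; rewrite normr_ge0 /=.
apply: le_trans (ler_normD _ _) _; rewrite normr1.
apply: (@le_trans _ _ (1 + K * rho ^+ k)%:C); last by rewrite lecR expR_ge1Dx.
by rewrite rmorphD rmorph1 lerD2l yK.
Qed.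

Lemma Re_bound (z : C) (a : R) : `|z| <= a%:C -> `|complex.Re z| <= a.
Proof. by rewrite -lecR; apply: le_trans; exact: normc_ge_Re. Qed.

Lemma Im_bound (z : C) (a : R) : `|z| <= a%:C -> `|complex.Im z| <= a.
Proof.
move=> za; rewrite -normrN -ReiNIm; apply: Re_bound.
by rewrite normrM (normc_def 'i) /= expr0n expr1n add0r sqrtr1 mulr1.
Qed.

Lemma cvg_series_geometric (u : nat -> R) (K rho : R) :
  0 <= rho < 1 -> (forall k, `|u k| <= K * rho ^+ k) ->
  cvgn (series u).
Proof.
move=> /andP[rho0 rho1] uK; apply: normed_cvg.
apply: (@series_le_cvg _ _ (geometric K rho)) => // [k|k|].
- exact: normr_ge0.
- exact: le_trans (uK k).
by apply: is_cvg_geometric_series; rewrite ger0_norm.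
Qed.

Lemma cvg_complex (u : nat -> C) (a b : R) :
  complex.Re (u n) @[n --> \oo] --> a -> complex.Im (u n) @[n --> \oo] --> b ->
  u n @[n --> \oo] --> a +i* b.
Proof.
move=> ua ub; apply/cvgrPdist_lt => e e0.
have eE : e = (complex.Re e)%:C by rewrite RRe_real// ger0_real// ltW.
move: e0; rewrite eE ltcR; move: (complex.Re e) => {e eE} e e0.
have e2 : 0 < e / 2 by rewrite divr_gt0.
move/cvgrPdist_lt : ua => /(_ _ e2) ua; move/cvgrPdist_lt : ub => /(_ _ e2) ub.
apply: filterS2 ua ub => n; case: (u n) => x y /= ax by'.
rewrite (_ : _ - _ = (a - x)%:C + 'i * (b - y)%:C); last first.
  by rewrite [LHS]complexE.
apply: le_lt_trans (ler_normD _ _) _; rewrite normrM !normc_def /=.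
rewrite !expr0n expr1n !addr0 add0r sqrtr1 mul1r !sqrtr_sqr.
by rewrite -rmorphD ltcR (splitr e); apply: ltrD.
Qed.

(** The partial products are bounded, so their increments [X n * y n] decay geometrically; the
    telescoping series then converges absolutely in the real and the imaginary part. *)
Lemma prod_geometric_cvg (y : nat -> C) (K rho : R) :
  0 <= rho < 1 -> (forall k, `|y k| <= (K * rho ^+ k)%:C) ->
  exists l : C, \prod_(k < n) (1 + y k) @[n --> \oo] --> l.
Proof.
move=> rho01 yK; pose X n := \prod_(k < n) (1 + y k).
have K0 : 0 <= K.
  by have := le_trans (normr_ge0 _) (yK 0); rewrite expr0 mulr1 lecR.
pose B := expR (K * (1 - rho)^-1).
have dX n : `|X n.+1 - X n| <= (B * K * rho ^+ n)%:C.
  rewrite /X big_ord_recr/= mulrDr mulr1 addrC addKr normrM -mulrA rmorphM.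
  by apply: ler_pM => //; exact: prod_geometric_bound.
have XE n : X n = 1 + \sum_(0 <= k < n) (X k.+1 - X k).
  by rewrite telescope_sumr// /X big_ord0 addrC subrK.
have ReX n : complex.Re (X n) =
    1 + series (fun k => complex.Re (X k.+1 - X k)) n.
  by rewrite {1}XE raddfD/= raddf_sum.
have ImX n : complex.Im (X n) =
    series (fun k => complex.Im (X k.+1 - X k)) n.
  by rewrite {1}XE raddfD/= raddf_sum /= add0r.
have cR : cvgn (series (fun k => complex.Re (X k.+1 - X k))).
  by apply: (cvg_series_geometric rho01) => k; apply: Re_bound; exact: dX.
have cI : cvgn (series (fun k => complex.Im (X k.+1 - X k))).
  by apply: (cvg_series_geometric rho01) => k; apply: Im_bound; exact: dX.
move/cvg_ex : cR => [a ha]; move/cvg_ex : cI => [b hb].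
exists ((1 + a) +i* b); apply: cvg_complex.
  under eq_cvg do rewrite ReX.
  by apply: cvgD => //; exact: cvg_cst.
by under eq_cvg do rewrite ImX.
Qed.

Variable p : C.
Hypothesis p1 : `|p| < 1.
Let rho := complex.Re `|p|.
Let rhoE : `|p| = rho%:C.
Proof. by rewrite RRe_real// normr_real. Qed.
Let rho01 : 0 <= rho < 1.
Proof. by rewrite -lecR -ltcR -rhoE normr_ge0. Qed.

Lemma qpoch_cvg (a : C) : qpoch a p n @[n --> \oo] --> qpoch_inf a p.
Proof.
have [|l lP] := @prod_geometric_cvg (fun k => - a * p ^+ k) (complex.Re `|a|) _ rho01.
  move=> k; rewrite normrM normrN normrX rhoE rmorphM rmorphXn RRe_real//.
  exact: normr_real.
have {}lP : qpoch a p n @[n --> \oo] --> l.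
  rewrite /qpoch; under eq_cvg => n do under eq_bigr => k _ do rewrite -mulNr.
  exact: lP.
by rewrite /qpoch_inf (cvg_lim _ lP).
Qed.

Lemma qfactor_neq0 (a : C) (k : nat) : `|a| < 1 -> 1 - a * p ^+ k != 0.
Proof.
move=> a1; rewrite subr_eq0; apply/eqP => /(congr1 (fun z => `|z|)).
rewrite normr1 normrM normrX => /esym E.
suff : `|a| * `|p| ^+ k < 1 by rewrite E ltxx.
apply: le_lt_trans a1; rewrite ler_piMr// exprn_ile1// ltW//.
Qed.

Lemma qpoch_neq0 (a : C) (n : nat) : `|a| < 1 -> qpoch a p n != 0.
Proof. by move=> a1; apply/prodf_neq0 => k _; exact: qfactor_neq0. Qed.

Lemma qpoch_bound (a : C) : exists K : R, forall n, `|qpoch a p n| <= K%:C.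
Proof.
exists (expR (complex.Re `|a| * (1 - rho)^-1)) => n.
rewrite /qpoch; under eq_bigr => k _ do rewrite -mulNr.
apply: (@prod_geometric_bound (fun k => - a * p ^+ k)) => // k.
rewrite normrM normrN normrX rhoE rmorphM rmorphXn RRe_real//.
exact: normr_real.
Qed.

Section Inverse.
Variable a : C.
Hypothesis a1 : `|a| < 1.
(** Chosen so that [1 + y k] is the inverse of the [k]-th factor: the inverse product is again of
    the form treated above. *)
Let y k := a * p ^+ k / (1 - a * p ^+ k).

Let yE n : (qpoch a p n)^-1 = \prod_(k < n) (1 + y k).
Proof.
rewrite /qpoch -prodfV; apply: eq_bigr => k _; rewrite /y.
by have := qfactor_neq0 k a1 => h; field.
Qed.

Let y_le : exists K : R, forall k, `|y k| <= (K * rho ^+ k)%:C.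
Proof.
have a1' : 0 < 1 - `|a| by rewrite subr_gt0.
have K_real : `|a| / (1 - `|a|) \is Num.real.
  by rewrite ger0_real// divr_ge0// ltW.
exists (complex.Re (`|a| / (1 - `|a|))) => k.
rewrite rmorphM rmorphXn /= (RRe_real K_real) -rhoE !normrM normfV normrX mulrAC.
rewrite ler_wpM2r// ?exprn_ge0// ler_wpM2l// lef_pV2 ?posrE//; last first.
  by rewrite normr_gt0 qfactor_neq0.
apply: le_trans (lerB_dist _ _); rewrite normr1 lerD2l lerN2 normrM normrX.
by rewrite ler_piMr// exprn_ile1// ltW.
Qed.

Lemma qpochV_bound : exists K : R, forall n, `|(qpoch a p n)^-1| <= K%:C.
Proof.
have [K yK] := y_le; exists (expR (K * (1 - rho)^-1)) => n.
by rewrite yE; exact: prod_geometric_bound.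
Qed.

(** The product of the inverses converges too, and the two limits multiply to 1. *)
Lemma qpoch_inf_neq0 : qpoch_inf a p != 0.
Proof.
have [K yK] := y_le; have [l lP] := prod_geometric_cvg rho01 yK.
have h : qpoch a p n * \prod_(k < n) (1 + y k) @[n --> \oo] -->
    qpoch_inf a p * l by exact: (cvgM (@qpoch_cvg a) lP).
have h1 : qpoch a p n * \prod_(k < n) (1 + y k) @[n --> \oo] --> (1 : C).
  under eq_cvg do rewrite -yE mulfV ?qpoch_neq0//.
  exact: cvg_cst.
have /eqP : qpoch_inf a p * l = 1 by exact: (cvg_unique _ h h1).
by apply: contraTneq => ->; rewrite mul0r eq_sym oner_eq0.
Qed.

End Inverse.

End Products.

(** * Finite q-series identities *)

Lemma bin2D (m k : nat) : 'C(m + k, 2) = ('C(m, 2) + 'C(k, 2) + m * k)%N.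
Proof.
elim: k => [|k IH]; first by rewrite addn0 muln0 addn0 bin0n addn0.
by rewrite addnS !binS !bin1 IH; lia.
Qed.

Lemma bin2_double (k : nat) : ('C(k, 2) + 'C(k, 2) + k = k * k)%N.
Proof. by elim: k => // k IH; rewrite !binS !bin1; lia. Qed.

(** This is [m(m-1)/2] on all integers, split by sign so that the value is visibly a natural number
    and no division occurs. *)
Definition tri (m : int) : int :=
  match m with Posz n => 'C(n, 2) | Negz n => 'C(n.+2, 2) end.

Lemma tri_double (m : int) : tri m + tri m = m * (m - 1).
Proof.
by case: m => n /=; [have := bin2_double n|have := bin2_double n.+2];
  rewrite ?NegzE; lia.
Qed.

Section Algebra.
Variable R : realType.
Local Notation C := R[i].

(* [1/(q;q)_k], which vanishes for negative [k]: bilateral sums such as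
   [sum_m al m / ((q)_{N-m} (q)_{N+m})] then have finite support. *)
Definition qinv (q : C) (k : int) : C :=
  if k is Posz n then (qpoch q q n)^-1 else 0.

#[global] Arguments qinv : simpl never.

Lemma qpochS (a q : C) (n : nat) :
  qpoch a q n.+1 = qpoch a q n * (1 - a * q ^+ n).
Proof. by rewrite /qpoch big_ord_recr. Qed.

Lemma qpoch0 (a q : C) : qpoch a q 0 = 1.
Proof. by rewrite /qpoch big_ord0. Qed.

Lemma qpochD (a q : C) (m n : nat) :
  qpoch a q (m + n) = qpoch a q m * qpoch (a * q ^+ m) q n.
Proof.
rewrite /qpoch big_split_ord /=; congr (_ * _).
by apply: eq_bigr => k _; rewrite exprD mulrA.
Qed.

Lemma qinv0 (q : C) : qinv q 0 = 1.
Proof. by rewrite -[0]/(Posz 0) /qinv qpoch0 invr1. Qed.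

Lemma qinv_lt0 (q : C) (k : int) : k < 0 -> qinv q k = 0.
Proof. by case: k. Qed.

Section QInv.
Variable q : C.
Hypothesis q0 : q != 0.
Hypothesis q1 : forall n, 1 - q * q ^+ n != 0.

Lemma qpoch_qq_neq0 (n : nat) : qpoch q q n != 0.
Proof. by apply/prodf_neq0. Qed.

Lemma qinv_rec (k : int) : (1 - q ^ k) * qinv q k = qinv q (k - 1).
Proof.
case: k => [[|n]|n].
- by rewrite expr0z subrr mul0r.
- rewrite (_ : Posz n.+1 - 1 = n); last by lia.
  rewrite /qinv qpochS -exprnP exprS invfM mulrCA mulfV ?mulr1//.
- by rewrite (_ : Negz n - 1 = Negz n.+1) ?mulr0//; lia.
Qed.

Lemma qinvS (n : nat) : qinv q n = (1 - q ^+ n.+1) * qinv q n.+1.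
Proof. by rewrite exprnP qinv_rec; congr qinv; lia. Qed.

(** The base [b] is separate from [q] because two cases matter: [b = q] gives the q-binomial theorem
    (for Euler's sum and the triple product), and [b = p] with [p^2 = q] gives the Bailey pairs. *)
Definition gsum (b x : C) (L : nat) : C :=
  \sum_(k < L.+1) (- x) ^+ k * b ^+ 'C(k, 2) * qinv q k * qinv q (L%:Z - k%:Z).

(** Replacing [x] by [q * x] multiplies term [k] by [q^k], and [1 - q^k] cancels the last factor of
    [(q;q)_k]. *)
Lemma gsum_rec (b x : C) (L : nat) :
  gsum b x L.+1 - gsum b (q * x) L.+1 = - x * gsum b (b * x) L.
Proof.
rewrite /gsum -sumrB big_ord_recl /= !expr0 subrr add0r mulr_sumr.
apply: eq_bigr => k _; rewrite /bump /= add1n.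
rewrite (_ : L.+1%:Z - k.+1%:Z = L%:Z - k%:Z); last by lia.
rewrite [in RHS]qinvS binS bin1 exprD -!mulrN !exprMn !exprS; ring.
Qed.

Lemma gauss_binomial (x : C) (L : nat) :
  gsum q x L = qpoch x q L * qinv q L.
Proof.
elim: L => [|L IH].
  by rewrite /gsum big_ord_recl big_ord0 /= !expr0 subrr qinv0 qpoch0 !mulr1 addr0.
have qL : 1 - q ^+ L.+1 != 0 by rewrite exprS.
apply: (mulfI qL).
have -> : (1 - q ^+ L.+1) * gsum q x L.+1 = (1 - x * q ^+ L) * gsum q x L.
  (* The q-Pascal rule: [1 - q^(L+1) = (1 - q^(L+1-k)) + q^(L+1-k) (1 - q^k)], where each half
     lowers the index of one [qinv]. *)
  transitivity (
    \sum_(k < L.+2) (- x) ^+ k * q ^+ 'C(k, 2) * qinv q k *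
       ((1 - q ^ (L.+1%:Z - k%:Z)) * qinv q (L.+1%:Z - k%:Z)) +
    \sum_(k < L.+2) (- x) ^+ k * q ^+ 'C(k, 2) * q ^ (L.+1%:Z - k%:Z) *
       ((1 - q ^ k%:Z) * qinv q k) * qinv q (L.+1%:Z - k%:Z)).
    rewrite -big_split mulr_sumr; apply: eq_bigr => k _ /=.
    rewrite (_ : q ^+ L.+1 = q ^ (L.+1%:Z - k%:Z) * q ^ k%:Z); last first.
      by rewrite -expfzDr// subrK.
    ring.
  under eq_bigr do rewrite qinv_rec.
  under [X in _ + X]eq_bigr do rewrite qinv_rec.
  rewrite big_ord_recr [X in _ + X]big_ord_recl /=.
  rewrite (_ : L.+1%:Z - L.+1%:Z - 1 = Negz 0); last by lia.
  rewrite (_ : 0%:Z - 1 = Negz 0); last by lia.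
  rewrite !(@qinv_lt0 q (Negz 0))//.
  rewrite !mulr0 !mul0r addr0 add0r mulrBl mul1r; congr (_ + _).
    apply: eq_bigr => k _ /=.
    by rewrite (_ : L.+1%:Z - k%:Z - 1 = L%:Z - k%:Z); last by lia.
  rewrite -mulNr /gsum mulr_sumr; apply: eq_bigr => k _ /=.
  rewrite /bump /= add1n.
  rewrite (_ : L.+1%:Z - k.+1%:Z = L%:Z - k%:Z); last by lia.
  rewrite (_ : k.+1%:Z - 1 = k%:Z); last by lia.
  rewrite binS bin1 exprD exprS.
  rewrite (_ : x * q ^+ L = x * (q ^+ k * q ^ (L%:Z - k%:Z))); first by ring.
  by rewrite !exprnP -expfzDr// addrC subrK.
by rewrite IH qpochS qinvS; ring.
Qed.

(** Induction on [M] by the same q-Pascal splitting. Its second half shifts [k] and turns [c] into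
    [c + 1], so [c] must stay general. *)
Lemma q_vandermonde (M : nat) (c : int) :
  \sum_(k < M.+1) q ^ (k%:Z * (k%:Z + c)) *
    qinv q (M%:Z - k%:Z) * qinv q k * qinv q (k%:Z + c) =
  qinv q M * qinv q (M%:Z + c).
Proof.
elim: M c => [|M IH] c.
  by rewrite big_ord_recl big_ord0 /= mul0r subrr qinv0 expr0z !mul1r addr0.
have qM : 1 - q ^+ M.+1 != 0 by rewrite exprS.
apply: (mulfI qM).
transitivity (
  \sum_(k < M.+2) q ^ (k%:Z * (k%:Z + c)) *
    ((1 - q ^ (M.+1%:Z - k%:Z)) * qinv q (M.+1%:Z - k%:Z)) * qinv q k *
    qinv q (k%:Z + c) +
  \sum_(k < M.+2) q ^ (k%:Z * (k%:Z + c)) * q ^ (M.+1%:Z - k%:Z) *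
    qinv q (M.+1%:Z - k%:Z) * ((1 - q ^ k%:Z) * qinv q k) *
    qinv q (k%:Z + c)).
  rewrite -big_split mulr_sumr; apply: eq_bigr => k _ /=.
  rewrite (_ : q ^+ M.+1 = q ^ (M.+1%:Z - k%:Z) * q ^ k%:Z); last first.
    by rewrite -expfzDr// subrK.
  ring.
under eq_bigr do rewrite qinv_rec.
under [X in _ + X]eq_bigr do rewrite qinv_rec.
rewrite big_ord_recr [X in _ + X]big_ord_recl /=.
rewrite (_ : M.+1%:Z - M.+1%:Z - 1 = Negz 0); last by lia.
rewrite (_ : 0%:Z - 1 = Negz 0); last by lia.
rewrite !(@qinv_lt0 q (Negz 0))//.
rewrite !mulr0 !mul0r addr0 add0r.
transitivity (qinv q M * qinv q (M%:Z + c) +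
    q ^ (M.+1%:Z + c) * (qinv q M * qinv q (M%:Z + (c + 1)))).
  rewrite -!IH mulr_sumr; congr (_ + _); apply: eq_bigr => k _ /=.
    by rewrite (_ : M.+1%:Z - k%:Z - 1 = M%:Z - k%:Z); last by lia.
  rewrite /bump /= add1n.
  rewrite (_ : M.+1%:Z - k.+1%:Z = M%:Z - k%:Z); last by lia.
  rewrite (_ : k.+1%:Z - 1 = k%:Z); last by lia.
  rewrite (_ : k.+1%:Z + c = k%:Z + (c + 1)); last by lia.
  rewrite -!expfzDr// !mulrA -expfzDr//; congr (q ^ _ * _ * _ * _); lia.
rewrite qinvS.
rewrite (_ : M%:Z + (c + 1) = M.+1%:Z + c); last by lia.
rewrite (_ : M%:Z + c = M.+1%:Z + c - 1); last by lia.
rewrite -qinv_rec; ring.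
Qed.

End QInv.
End Algebra.

(** * Bailey pairs *)

Section Bailey.
Variable R : realType.
Local Notation C := R[i].

Section Step.
Variable q : C.
Hypothesis q0 : q != 0.
Hypothesis q1 : forall n, 1 - q * q ^+ n != 0.

(** Terms with [s < m] vanish; putting [s = m + k] leaves [q_vandermonde] with [N - m] for [M] and
    [2m + c] for its shift. *)
Let bailey_sum_ge0 (c : nat) (N m : nat) :
  \sum_(s < N.+1) q ^ (s%:Z * (s%:Z + c%:Z) - m%:Z * (m%:Z + c%:Z)) *
    qinv q (N%:Z - s%:Z) * qinv q (s%:Z - m%:Z) * qinv q (s%:Z + m%:Z + c%:Z) =
  qinv q (N%:Z - m%:Z) * qinv q (N%:Z + m%:Z + c%:Z).
Proof.
have [mN|Nm] := leqP m N; last first.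
  rewrite (@qinv_lt0 _ q (N%:Z - m%:Z)) ?mul0r; last by lia.
  rewrite big1// => s _; rewrite (@qinv_lt0 _ q (s%:Z - m%:Z)) ?mulr0 ?mul0r//.
  by have := ltn_ord s; lia.
have [M ->] : exists M, N = (m + M)%N by exists (N - m)%N; rewrite subnKC.
rewrite -addnS big_split_ord big1 ?Monoid.mul1m; last first.
  move=> s _; rewrite (@qinv_lt0 _ q (s%:Z - m%:Z)) ?mulr0 ?mul0r//.
  by have := ltn_ord s; lia.
rewrite (_ : (m + M)%:Z - m%:Z = M%:Z); last by lia.
rewrite (_ : (m + M)%:Z + m%:Z + c%:Z = M%:Z + (m + m + c)%:Z); last by lia.
rewrite -q_vandermonde//; apply: eq_bigr => k _.
rewrite [nat_of_ord (rshift _ _)]/=.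
by congr (q ^ _ * qinv q _ * qinv q _ * qinv q _); lia.
Qed.

Lemma bailey_sum (c : nat) (N : nat) (m : int) : (c <= 1)%N ->
  \sum_(s < N.+1) q ^+ (s * (s + c)) * qinv q (N%:Z - s%:Z) *
    (qinv q (s%:Z - m) * qinv q (s%:Z + m + c%:Z)) =
  q ^ (m * (m + c%:Z)) * (qinv q (N%:Z - m) * qinv q (N%:Z + m + c%:Z)).
Proof.
move=> c1; wlog m0 : m / 0 <= m => [H|].
  have [/H //|mlt0] := leP 0 m.
  (* The reflection [m -> -m-c] swaps the two kernels and fixes [m(m+c)]. The bound [c <= 1] ensures
     that it sends negative [m] to nonnegative ones. *)
  have h : 0 <= - m - c%:Z by lia.
  have := H _ h.
  rewrite (_ : (- m - c%:Z) * (- m - c%:Z + c%:Z) = m * (m + c%:Z)); last by lia.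
  rewrite (_ : N%:Z - (- m - c%:Z) = N%:Z + m + c%:Z); last by lia.
  rewrite (_ : N%:Z + (- m - c%:Z) + c%:Z = N%:Z - m); last by lia.
  rewrite [X in _ = _ * X]mulrC => <-; apply: eq_bigr => s _; congr (_ * _).
  by rewrite mulrC; congr (qinv q _ * qinv q _); lia.
case: m m0 => // m _; rewrite -bailey_sum_ge0 mulr_sumr.
apply: eq_bigr => s _; rewrite !mulrA -expfzDr// exprnP.
by congr (q ^ _ * _ * _ * _); lia.
Qed.

(* [c] is 0 for Bailey pairs relative to [a = 1] and 1 for [a = q]. *)
Lemma bailey_step (c : nat) (al : int -> C) (be : nat -> C) (N : nat) :
  (c <= 1)%N ->
  (forall n, has_sum (fun m => al m * (qinv q (n%:Z - m) * qinv q (n%:Z + m + c%:Z)))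
    (be n)) ->
  has_sum (fun m => al m * q ^ (m * (m + c%:Z)) *
      (qinv q (N%:Z - m) * qinv q (N%:Z + m + c%:Z)))
    (\sum_(s < N.+1) q ^+ (s * (s + c)) * qinv q (N%:Z - s%:Z) * be s).
Proof.
move=> c1 ab; pose w s := q ^+ (s * (s + c)) * qinv q (N%:Z - s%:Z).
have wab (s : 'I_N.+1) := has_sumZ (c := w s) (ab s).
apply: (has_sum_eq (has_sum_sum (r := index_enum 'I_N.+1) wab)).
move=> m; rewrite -mulrA -bailey_sum// mulr_sumr.
apply: eq_bigr => s _; rewrite /w; ring.
Qed.

End Step.

(** The kernel lives on [n - L <= m <= n], since [qinv] vanishes at negative arguments; [k = n - m]
    runs through this window. *)
Lemma has_sum_window (q : C) (F : int -> C) (L : nat) (n : int) :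
  has_sum (fun m => F m * (qinv q (n - m) * qinv q (L%:Z - n + m)))
    (\sum_(k < L.+1) F (n - k%:Z) * (qinv q k * qinv q (L%:Z - k%:Z))).
Proof.
have := @has_sum_finite R _
  (fun m => F m * (qinv q (n - m) * qinv q (L%:Z - n + m)))
  [seq n - k%:Z | k <- iota 0 L.+1].
rewrite big_map -[iota 0 L.+1]/(index_iota 0 L.+1) big_mkord.
rewrite (eq_bigr (fun k : 'I_L.+1 =>
    F (n - k%:Z) * (qinv q k * qinv q (L%:Z - k%:Z)))); last first.
  by move=> k _; congr (_ * (qinv q _ * qinv q _)); lia.
apply.
  by rewrite map_inj_uniq ?iota_uniq// => i j; lia.
move=> m /mapP mP; have [m1|m1] := boolP (n - m < 0).
  by rewrite qinv_lt0// mul0r mulr0.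
have [m2|m2] := boolP (L%:Z - n + m < 0).
  by rewrite (@qinv_lt0 _ _ (L%:Z - n + m))// !mulr0.
case: mP; exists `|n - m|%N; last by lia.
by rewrite mem_index_iota; lia.
Qed.

Lemma has_sum_gsum (q b z : C) (L n : nat) : b != 0 -> z != 0 ->
  has_sum (fun m => (-1) ^ m * z ^ m * b ^ tri m *
      (qinv q (n%:Z - m) * qinv q (L%:Z - n%:Z + m)))
    ((-1) ^+ n * z ^+ n * b ^ tri n * gsum q b (z^-1 * b ^ (1 - n%:Z)) L).
Proof.
move=> b0 z0.
have := @has_sum_window q (fun m => (-1) ^ m * z ^ m * b ^ tri m) L n.
rewrite (_ : \sum_(k < L.+1) _ = (-1) ^+ n * z ^+ n * b ^ tri n *
  gsum q b (z^-1 * b ^ (1 - n%:Z)) L)//.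
rewrite /gsum mulr_sumr; apply: eq_bigr => k _; rewrite !mulrA; congr (_ * _ * _).
have N10 : (-1 : C) != 0 by rewrite oppr_eq0 oner_eq0.
have -> : tri (n%:Z - k%:Z) = tri n + (1 - n%:Z) * k%:Z + 'C(k, 2)%:Z.
  have := bin2_double k.
  by have := tri_double (n%:Z - k%:Z); have := tri_double n%:Z; lia.
rewrite (exprNn (_ * _)) exprMn (exprnP (b ^ _)) exprz_exp.
rewrite !(expfzDr _ _ N10) !(expfzDr _ _ z0) !(expfzDr _ _ b0).
rewrite -!invr_expz -!exprnP -(exprVn (-1)) invrN1 (exprVn z); ring.
Qed.

(** * The two base Bailey pairs, from sums in base [p = q^(1/2)] *)

Section Base.
Variable p : C.
Hypothesis p0 : p != 0.
Hypothesis p1 : `|p| < 1.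
Local Notation q := (p ^+ 2).

Let q0 : q != 0. Proof. by rewrite expf_neq0. Qed.
Let qlt1 : `|q| < 1. Proof. by rewrite normrX exprn_ilt1. Qed.
Let q1 n : 1 - q * q ^+ n != 0. Proof. exact: qfactor_neq0. Qed.
Local Notation h L c := (gsum q p (p ^ (c : int)) L).

(** Reversal [k -> L - k] of the summation index; in terms of the exponent [c] of [x = p^c] it is
    the reflection about [(1-L)/2]. *)
Lemma gsum_rev (L : nat) (c : int) :
  h L c = (-1) ^+ L * p ^ (c * L%:Z + 'C(L, 2)%:Z) * h L (1 - L%:Z - c).
Proof.
rewrite /gsum (reindex_inj rev_ord_inj) mulr_sumr; apply: eq_bigr => k _ /=.
rewrite subSS; move: (leq_ord k); move: (nat_of_ord k) => {}k kL.
have [m ->] : exists m, L = (m + k)%N by exists (L - k)%N; rewrite subnK.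
rewrite addnK (_ : (m + k)%:Z - m%:Z = k%:Z); last by lia.
rewrite (_ : (m + k)%:Z - k%:Z = m%:Z); last by lia.
rewrite !(exprNn (p ^ _)) !(exprnP (p ^ _)) !exprz_exp exprD.
have E : p ^ (c * m%:Z) * p ^+ 'C(m, 2) = p ^ (c * (m + k)%:Z + 'C(m + k, 2)%:Z) *
    (p ^ ((1 - (m + k)%:Z - c) * k%:Z) * p ^+ 'C(k, 2)).
  rewrite !exprnP -!expfzDr//; congr (p ^ _).
  by rewrite bin2D; have := bin2_double k; lia.
transitivity ((-1) ^+ m * ((-1) ^+ k * (-1) ^+ k) *
    (p ^ (c * m%:Z) * p ^+ 'C(m, 2)) * (qinv q m * qinv q k)).
  by rewrite -expr2 sqrr_sign; ring.
by rewrite E; ring.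
Qed.

Let h_rec (L : nat) (c : int) :
  h L.+1 c - h L.+1 (c + 2) = - p ^ c * h L (c + 1).
Proof.
have -> : p ^ (c + 2) = q * p ^ c by rewrite expfzDr// mulrC.
have -> : p ^ (c + 1) = p * p ^ c by rewrite expfzDr// mulrC.
exact: gsum_rec.
Qed.

Let expN (n : nat) : p ^ (- n%:Z) = (p ^+ n)^-1.
Proof. by rewrite -invr_expz. Qed.

Let p_neq0 (n : nat) : p ^+ n != 0. Proof. by rewrite expf_neq0. Qed.

Let bin_2n (n : nat) : 'C(n.*2, 2) = (n * (n.*2).-1)%N.
Proof. by case: n => // n; have := bin2_double n.+1.*2; rewrite /=; lia. Qed.

Let bin_2n1 (n : nat) : 'C(n.*2.+1, 2) = (n * n.*2.+1)%N.
Proof. by have := bin2_double n.*2.+1; lia. Qed.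

(** For length [2n+1] the reflection fixes [c = -n] and the sign is [-1], so the sum is its own
    opposite. *)
Let h_center (n : nat) : h n.*2.+1 (- n%:Z) = 0.
Proof.
have /eqP := gsum_rev n.*2.+1 (- n%:Z).
rewrite (_ : 1 - _ - _ = - n%:Z); last by lia.
rewrite bin_2n1 (_ : _ + _ = 0); last by lia.
rewrite expr0z mulr1 -signr_odd /= odd_double expr1 mulN1r -addr_eq0.
by rewrite -mulr2n mulrn_eq0 => /eqP.
Qed.

Let h_even (n : nat) : h n.*2 (1 - n%:Z) = p ^+ n * h n.*2 (- n%:Z).
Proof.
rewrite gsum_rev (_ : 1 - _ - _ = - n%:Z); last by lia.
rewrite (_ : _ + _ = n%:Z); last by case: n => // n; rewrite bin_2n; lia.
by rewrite -signr_odd odd_double mul1r.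
Qed.

(* [gsum_rec] relates sums of length [2n], [2n+1] and [2n+2], and reversal makes
   the central sum of odd length vanish ([h_center]); together they determine
   the sums next to the centre. *)
Lemma gsum_odd2 (n : nat) : h n.*2.+1 (2 - n%:Z) = h n.*2 (- n%:Z).
Proof.
have := h_rec n.*2 (- n%:Z).
rewrite (_ : - n%:Z + 1 = 1 - n%:Z); last by lia.
rewrite (_ : - n%:Z + 2 = 2 - n%:Z); last by lia.
by rewrite h_center h_even expN mulrA mulNr mulVf// mulN1r sub0r => /oppr_inj.
Qed.

Let h_odd_rev (n : nat) :
  h n.*2.+1 (- n.+1%:Z) = - (p ^+ n.*2.+1)^-1 * h n.*2.+1 (1 - n%:Z).
Proof.
rewrite gsum_rev (_ : 1 - _ - _ = 1 - n%:Z); last by lia.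
rewrite bin_2n1 (_ : _ + _ = - n.*2.+1%:Z); last by lia.
by rewrite expN -signr_odd /= odd_double expr1 mulN1r mulNr.
Qed.

(** The exponents [-n-1] and [1-n] are mirror images under reversal and also differ by 2, the step
    of the recurrence; the two relations form a linear equation for one unknown. *)
Lemma gsum_odd1 (n : nat) :
  (1 + p ^+ n.*2.+1) * h n.*2.+1 (1 - n%:Z) = p ^+ n * h n.*2 (- n%:Z).
Proof.
have := h_rec n.*2 (- n.+1%:Z).
rewrite (_ : - n.+1%:Z + 2 = 1 - n%:Z); last by lia.
rewrite (_ : - n.+1%:Z + 1 = - n%:Z); last by lia.
rewrite h_odd_rev expN => /(congr1 (fun x => - p ^+ n.*2.+1 * x)).
have E : p ^+ n.*2.+1 = p ^+ n.+1 * p ^+ n by rewrite -exprD; congr (_ ^+ _); lia.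
rewrite E => H.
transitivity (- (p ^+ n.+1 * p ^+ n) *
  (- (p ^+ n.+1 * p ^+ n)^-1 * h n.*2.+1 (1 - n%:Z) - h n.*2.+1 (1 - n%:Z))).
  by field; rewrite !p_neq0.
by rewrite H; field; rewrite p_neq0.
Qed.

Lemma gsum_even0 (n : nat) :
  (1 - p ^+ (2 * 2 * n.+1)) * h n.+1.*2 (- n.+1%:Z) = h n.*2.+1 (1 - n%:Z).
Proof.
(* By the recurrence these two sums differ by a multiple of the vanishing central sum. *)
have V : h n.+1.*2 (1 - n%:Z) = h n.+1.*2 (- n.+1%:Z).
  have := h_rec n.*2.+1 (- n.+1%:Z); rewrite -doubleS.
  rewrite (_ : - n.+1%:Z + 1 = - n%:Z); last by lia.
  rewrite (_ : - n.+1%:Z + 2 = 1 - n%:Z); last by lia.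
  by rewrite (h_center n) mulr0 => /subr0_eq/esym.
have := h_rec n.*2.+1 (- n.+2%:Z).
rewrite (_ : - n.+2%:Z + 1 = - n.+1%:Z); last by lia.
rewrite (_ : - n.+2%:Z + 2 = 1 - n.+1%:Z); last by lia.
rewrite h_odd_rev -doubleS h_even (gsum_rev _ (- n.+2%:Z)).
rewrite (_ : 1 - _ - _ = 1 - n%:Z); last by lia.
rewrite V bin_2n (_ : _ + _ = - (n.+1 * 3)%:Z); last by lia.
rewrite -signr_odd odd_double mul1r !expN => H.
apply: (mulfI (invr_neq0 (p_neq0 (n.+1 * 3)))).
rewrite (_ : 2 * 2 * n.+1 = n.+1 + n.+1 * 3)%N; last by lia.
transitivity ((p ^+ (n.+1 * 3))^-1 * h n.+1.*2 (- n.+1%:Z) -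
  p ^+ n.+1 * h n.+1.*2 (- n.+1%:Z)).
  by rewrite exprD; field; rewrite p_neq0.
rewrite H (_ : n.+1 * 3 = n.+2 + n.*2.+1)%N; last by lia.
by rewrite exprD; field; rewrite !p_neq0.
Qed.

(** [gsum_odd1] and [gsum_even0] compose to a one-term recurrence from [n] to [n+1]; its factors
    [1 + p^(2n+1)] and [1 - p^(4(n+1))] accumulate into the two denominators. *)
Lemma gsum_even0E (n : nat) : h n.*2 (- n%:Z) =
  p ^+ 'C(n, 2) / (qpoch (- p) q n * qpoch (q ^+ 2) (q ^+ 2) n).
Proof.
have pN1 : `|- p| < 1 by rewrite normrN.
elim: n => [|n IH].
  rewrite /gsum big_ord_recl big_ord0 /= !qpoch0 !expr0 !mul1r subrr qinv0.
  by rewrite addr0 mulr1 invr1.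
have n1 : 1 - - p * q ^+ n != 0 by exact: qfactor_neq0.
have q21 : `|q ^+ 2| < 1 by rewrite normrX exprn_ilt1.
have n2 : 1 - q ^+ 2 * (q ^+ 2) ^+ n != 0 by exact: qfactor_neq0.
have := gsum_odd1 n; rewrite -gsum_even0 IH.
rewrite (_ : 1 + p ^+ _ = 1 - - p * q ^+ n); last first.
  by rewrite exprS -mul2n exprM; ring.
rewrite (_ : 1 - p ^+ _ = 1 - q ^+ 2 * (q ^+ 2) ^+ n); last first.
  by rewrite -exprS -!exprM mulnA.
move=> H; apply: (mulfI n2); apply: (mulfI n1); rewrite H !qpochS binS bin1 exprD.
have A0 : qpoch (- p) q n != 0 by exact: qpoch_neq0.
have B0 : qpoch (q ^+ 2) (q ^+ 2) n != 0 by exact: qpoch_neq0.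
move: (1 - - p * q ^+ n) (1 - q ^+ 2 * (q ^+ 2) ^+ n) (qpoch (- p) q n)
  (qpoch (q ^+ 2) (q ^+ 2) n) n1 n2 A0 B0.
by move=> X Y A B X0 Y0 A0 B0; field; rewrite ?X0 ?Y0 ?A0 ?B0.
Qed.

(** The relevant values are [d = -1], where [gsum_odd2] evaluates the right side, and [d = 0], where
    [gsum_odd1] does. *)
Let base_window (n : nat) (d : int) :
  has_sum (fun m => (-1) ^ m * p ^ (d * m) * p ^ tri m *
      (qinv q (n%:Z - m) * qinv q (n%:Z + m + 1%:Z)))
    ((-1) ^+ n * p ^ (d * n%:Z + tri n) * h n.*2.+1 (1 - d - n%:Z)).
Proof.
have pd0 : p ^ d != 0 by rewrite expfz_neq0.
have H := @has_sum_gsum q _ _ n.*2.+1 n p0 pd0.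
have E1 : (p ^ d) ^+ n = p ^ (d * n%:Z) by rewrite exprnP exprz_exp.
have E2 : (p ^ d)^-1 * p ^ (1 - n%:Z) = p ^ (1 - d - n%:Z).
  by rewrite invr_expz -expfzDr//; congr (p ^ _); lia.
have -> : (-1) ^+ n * p ^ (d * n%:Z + tri n) * h n.*2.+1 (1 - d - n%:Z) =
    (-1) ^+ n * (p ^ d) ^+ n * p ^ tri n *
      gsum q p ((p ^ d)^-1 * p ^ (1 - n%:Z)) n.*2.+1.
  by rewrite E2 E1 expfzDr// mulrA.
refine (has_sum_eq H _) => m; rewrite exprz_exp; congr (_ * (_ * qinv _ _)); lia.
Qed.

Lemma base_pair0 (n : nat) :
  has_sum (fun m => (-1) ^ m * p ^ (tri m - m) *
      (qinv q (n%:Z - m) * qinv q (n%:Z + m + 1%:Z)))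
    ((-1) ^+ n * p ^ (n%:Z * n%:Z - 2 * n%:Z) /
      (qpoch (- p) q n * qpoch (q ^+ 2) (q ^+ 2) n)).
Proof.
have H := @base_window n (-1).
have -> : (-1) ^+ n * p ^ (n%:Z * n%:Z - 2 * n%:Z) /
      (qpoch (- p) q n * qpoch (q ^+ 2) (q ^+ 2) n) =
    (-1) ^+ n * p ^ (-1 * n%:Z + tri n) * h n.*2.+1 (1 - -1 - n%:Z).
  rewrite (_ : 1 - -1 - n%:Z = 2 - n%:Z); last by lia.
  rewrite gsum_odd2 gsum_even0E (_ : n%:Z * n%:Z - 2 * n%:Z =
    -1 * n%:Z + tri n + 'C(n, 2)%:Z); last by have := tri_double n; rewrite /=; lia.
  by rewrite [in LHS]expfzDr// !mulrA.
refine (has_sum_eq H _) => m; rewrite -(mulrA ((-1) ^ m) (p ^ _)) -expfzDr//.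
by congr (_ * p ^ _ * _); lia.
Qed.

(** The factor [1 + p] turns [(-p;q)_n (1 + p^(2n+1))] into [(-p^3;q)_n], the product that the sum
    over [n_1] cancels in part (1). *)
Lemma base_pair1 (n : nat) :
  has_sum (fun m => (1 + p) * ((-1) ^ m * p ^ tri m) *
      (qinv q (n%:Z - m) * qinv q (n%:Z + m + 1%:Z)))
    ((-1) ^+ n * p ^ (n%:Z * n%:Z) /
      (qpoch (- p ^+ 3) q n * qpoch (q ^+ 2) (q ^+ 2) n)).
Proof.
have H := has_sumZ (c := 1 + p) (@base_window n 0).
have c1 : 1 - 0 - n%:Z = 1 - n%:Z by lia.
have c2 : n%:Z * n%:Z = 0 * n%:Z + tri n + (n%:Z + 'C(n, 2)%:Z).
  by have := tri_double n; rewrite /=; lia.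
have A0 : qpoch (- p) q n != 0 by apply: qpoch_neq0 => //; rewrite normrN.
have p31 : `|- p ^+ 3| < 1 by rewrite normrN normrX exprn_ilt1.
have A0' : qpoch (- p ^+ 3) q n != 0 by exact: qpoch_neq0.
have q21 : `|q ^+ 2| < 1 by rewrite normrX exprn_ilt1.
have B0 : qpoch (q ^+ 2) (q ^+ 2) n != 0 by exact: qpoch_neq0.
have n1 : 1 + p ^+ n.*2.+1 != 0.
  have := @qfactor_neq0 _ _ qlt1 (- p) n; rewrite normrN mulNr opprK.
  by rewrite -exprM -exprS mul2n; exact.
have pE : (1 + p) * qpoch (- p ^+ 3) q n =
    qpoch (- p) q n * (1 + p ^+ n.*2.+1).
  rewrite (_ : 1 + p ^+ n.*2.+1 = 1 - - p * q ^+ n); last first.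
    by rewrite mulNr opprK -exprM -exprS mul2n.
  rewrite -qpochS -(add1n n) qpochD qpochS qpoch0 expr0 mul1r mulr1 opprK.
  by rewrite expr1 mulNr -exprS.
have -> : (-1) ^+ n * p ^ (n%:Z * n%:Z) /
      (qpoch (- p ^+ 3) q n * qpoch (q ^+ 2) (q ^+ 2) n) =
    (1 + p) * ((-1) ^+ n * p ^ (0 * n%:Z + tri n) * h n.*2.+1 (1 - 0 - n%:Z)).
  have [E [EE ->]] : exists E, p ^ (n%:Z * n%:Z) = E * (p ^+ n * p ^+ 'C(n, 2)) /\
      p ^ (0 * n%:Z + tri n) = E.
    exists (p ^ (0 * n%:Z + tri n)); split=> //.
    by rewrite c2 !exprnP -!expfzDr.
  rewrite c1 EE; apply: (mulfI n1).
  rewrite (mulrCA _ (1 + p)) (mulrCA _ (_ * E)) gsum_odd1 gsum_even0E.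
  apply: (mulfI A0); apply: (mulfI A0').
  transitivity ((qpoch (- p) q n * (1 + p ^+ n.*2.+1)) *
    ((-1) ^+ n * E * (p ^+ n * p ^+ 'C(n, 2)) /
    qpoch (q ^+ 2) (q ^+ 2) n)).
    move: (qpoch (- p ^+ 3) q n) (qpoch (- p) q n) (qpoch (q ^+ 2) (q ^+ 2) n) A0' B0.
    move: (1 + p ^+ n.*2.+1).
    by move=> D X A B X0 B0; field; rewrite ?X0 ?B0.
  rewrite -pE.
  move: (qpoch (- p ^+ 3) q n) (qpoch (- p) q n) (qpoch (q ^+ 2) (q ^+ 2) n) A0 B0.
  by move=> X A B A0 B0; field; rewrite ?A0 ?B0.
refine (has_sum_eq H _) => m; rewrite mul0r expr0z mulr1; ring.
Qed.

End Base.
End Bailey.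

(** * The Jacobi triple product *)

Section Jacobi.
Variable R : realType.
Local Notation C := R[i].

Lemma bounded_by_exhaustion (I : choiceType) (g : I -> R) (S : nat -> seq I) (M : R) :
  (forall i, 0 <= g i) -> (forall N, uniq (S N)) ->
  (forall A : {fset I}, exists N, {subset A <= S N}) ->
  (forall N, \sum_(i <- S N) g i <= M) ->
  forall A : {fset I}, \sum_(i <- A) g i <= M.
Proof.
move=> g0 uS exS SM A; have [N AN] := exS A; apply: le_trans (SM N).
have -> : \sum_(i <- S N) g i = \sum_(i <- [fset i in S N]%fset) g i.
  by apply: perm_big; apply: uniq_perm => // i; rewrite !inE.
have sub : (A `<=` [fset i in S N])%fset by apply/fsubsetP => i /AN; rewrite inE.
by rewrite -(fsetUidPr _ _ sub) big_fsetUD lerDl; apply: sumr_ge0.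
Qed.

Lemma int_geometric_bound (K rho : R) : 0 <= K -> 0 <= rho < 1 ->
  forall A : {fset int}, \sum_(m <- A) K * rho ^+ `|m|%N <= K * ((1 - rho)^-1 *+ 2).
Proof.
move=> K0 /[dup] rho01 /andP[rho0 rho1].
apply: (@bounded_by_exhaustion _ _
  (fun N => [seq Posz k | k <- iota 0 N] ++ [seq Negz k | k <- iota 0 N])).
- by move=> m; rewrite mulr_ge0// exprn_ge0.
- move=> N; rewrite cat_uniq !map_inj_uniq ?iota_uniq ?andbT /=; last 2 first.
  + by move=> i j [].
  + by move=> i j [].
  by apply/hasPn => _ /mapP[k _ ->]; apply/mapP => -[].
- move=> A; exists (\max_(m <- A) `|m|%N).+1 => m mA.
  have mN : (`|m| < (\max_(m <- A) `|m|%N).+1)%N by rewrite ltnS leq_bigmax_seq.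
  rewrite mem_cat; case: m mA mN => k kA kN.
    by rewrite map_f ?mem_iota.
  by rewrite [X in _ || X]map_f ?orbT// mem_iota; move: kN; rewrite /=; lia.
- move=> N; rewrite big_cat /= !big_map -mulr_sumr -mulr_sumr -mulrDr.
  rewrite ler_wpM2l// mulr2n.
  have -> : iota 0 N = index_iota 0 N by rewrite /index_iota subn0.
  rewrite !big_mkord /=.
  apply: lerD; first exact: geometric_bound.
  apply: le_trans (geometric_bound N rho01); apply: ler_sum => k _.
  by rewrite exprS ler_piMl// ?exprn_ge0// ltW.
Qed.

Lemma cvg_shift (u : nat -> C) (l : C) (f : nat -> nat) (K : nat) :
  (forall N, (N <= f N + K)%N) -> u n @[n --> \oo] --> l ->
  u (f n) @[n --> \oo] --> l.
Proof.
move=> fK ul; suff foo : f n @[n --> \oo] --> \oo by exact: (cvg_comp _ _ foo ul).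
move=> A [B _ BA]; exists (B + K)%N => // n /= Bn; apply: BA => /=.
by have := fK n; lia.
Qed.

Section Nome.
Variable q : C.
Hypothesis q0 : q != 0.
Hypothesis q1 : `|q| < 1.

Lemma qinv_cvg (f : nat -> int) (K : nat) : (forall N, N%:Z <= f N + K%:Z) ->
  qinv q (f N) @[N --> \oo] --> (qpoch_inf q q)^-1.
Proof.
move=> fK.
have h : (qpoch q q n)^-1 @[n --> \oo] --> (qpoch_inf q q)^-1.
  exact: (cvgV (qpoch_inf_neq0 q1 q1) (@qpoch_cvg _ _ q1 q)).
have h' : (qpoch q q `|f N|%N)^-1 @[N --> \oo] --> (qpoch_inf q q)^-1.
  by apply: (@cvg_shift _ _ (fun N => `|f N|%N) K _ h) => N; have := fK N; lia.
apply: cvg_trans h'; apply: near_eq_cvg; exists K => // N /= KN.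
by have := fK N; case: (f N) => n //; lia.
Qed.

Lemma qinv_bound : exists K : R, forall k, `|qinv q k| <= K%:C.
Proof.
have [K KP] := qpochV_bound q1 q1; exists K => -[n|n]; first exact: KP.
by rewrite qinv_lt0// normr0; exact: le_trans (normr_ge0 _) (KP 0).
Qed.

(** The q-binomial theorem of length [2N] at [x = q^(1-N) / z]. The last [N] factors of [(x;q)_(2N)]
    are [(q/z;q)_N]; the first [N], reversed and freed of a monomial, are [(z;q)_N]. *)
Lemma finite_triple_product (z : C) (N : nat) : z != 0 ->
  has_sum (fun m => (-1) ^ m * z ^ m * q ^ tri m *
      (qinv q (N%:Z - m) * qinv q (N%:Z + m)))
    (qpoch z q N * qpoch (q / z) q N * qinv q (N + N)%:Z).
Proof.
move=> z0; have H := @has_sum_gsum _ q _ _ (N + N) N q0 z0.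
have q1' n : 1 - q * q ^+ n != 0 by exact: qfactor_neq0.
have -> : qpoch z q N * qpoch (q / z) q N * qinv q (N + N)%:Z =
    (-1) ^+ N * z ^+ N * q ^ tri N * gsum q q (z^-1 * q ^ (1 - N%:Z)) (N + N).
  rewrite gauss_binomial// qpochD !mulrA; congr (_ * _).
  rewrite (_ : z^-1 * q ^ (1 - N%:Z) * q ^+ N = q / z); last first.
    by rewrite exprnP -mulrA -expfzDr// subrK mulrC.
  congr (_ * _); rewrite [in RHS]/qpoch (reindex_inj rev_ord_inj) /=.
  have -> : (-1) ^+ N * z ^+ N * q ^ tri N = \prod_(k < N) (- (z * q ^+ k)).
    elim: (N) => [|n IH]; first by rewrite big_ord0 !expr0 !mul1r.
    by rewrite big_ord_recr -IH /= binS bin1 -!exprnP !exprS exprD; ring.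
  rewrite -big_split /qpoch; apply: eq_bigr => k _ /=.
  have -> : z^-1 * q ^ (1 - N%:Z) * q ^+ (N - k.+1) = z^-1 * (q ^+ k)^-1.
    rewrite -mulrA exprnP -expfzDr// exprnP invr_expz.
    by congr (_ * q ^ _); have := ltn_ord k; lia.
  by field; rewrite z0 expf_neq0.
refine (has_sum_eq H _) => m; congr (_ * (_ * qinv _ _)); lia.
Qed.

Section Limit.
Variables (al : int -> C) (K rho : R) (c : nat) (be : nat -> C).
Hypothesis rho01 : 0 <= rho < 1.
Hypothesis al_bound : forall m, `|al m| <= (K * rho ^+ `|m|%N)%:C.
Hypothesis al_be : forall N : nat,
  has_sum (fun m => al m * (qinv q (N%:Z - m) * qinv q (N%:Z + m + c%:Z))) (be N).
Local Notation w := (qpoch_inf q q)^-1.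

Let F N m := al m * (qinv q (N%:Z - m) * qinv q (N%:Z + m + c%:Z)).

Let F_cvg m : F N m @[N --> \oo] --> al m * (w * w).
Proof.
apply: (cvgM (cvg_cst (al m))); apply: cvgM.
  by apply: (@qinv_cvg _ `|m|%N) => N; lia.
by apply: (@qinv_cvg _ `|m|%N) => N; lia.
Qed.

Let F_bound : exists2 K', 0 <= K' &
  forall N m, `|F N m| <= (K' * rho ^+ `|m|%N)%:C.
Proof.
have [Q QP] := qinv_bound.
have K0 : 0 <= K.
  by have := le_trans (normr_ge0 _) (al_bound 0); rewrite mulr1 lecR.
have Q0 : 0 <= Q by have := le_trans (normr_ge0 _) (QP 0); rewrite lecR.
exists (K * (Q * Q)) => [|N m]; first by rewrite !mulr_ge0.
rewrite mulrAC rmorphM /= normrM; apply: ler_pM => //.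
by rewrite normrM rmorphM; apply: ler_pM.
Qed.

Lemma bailey_limit (S : C) :
  has_sum al S -> be N @[N --> \oo] --> S * (w * w).
Proof.
move=> alS; have [K' K'0 FK] := F_bound.
have -> : S * (w * w) = w * w * S by rewrite mulrC.
apply: (dominated_cvg (int_geometric_bound K'0 rho01) FK F_cvg al_be).
by refine (has_sum_eq (has_sumZ (c := w * w) alS) _) => m; rewrite mulrC.
Qed.

(** The limit read backwards: knowing the limit of beta sums the alpha series. This turns the finite
    triple product into the infinite one. *)
Lemma bailey_limit_inv (S : C) :
  be N @[N --> \oo] --> w * w * S -> has_sum al S.
Proof.
move=> beS; have [K' K'0 FK] := F_bound.
have w0 : w != 0 by rewrite invr_eq0 qpoch_inf_neq0.
have H := dominated_has_sum (int_geometric_bound K'0 rho01) FK F_cvg al_be beS.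
have -> : S = (w * w)^-1 * (w * w * S) by rewrite mulKf// mulf_neq0.
refine (has_sum_eq (has_sumZ (c := (w * w)^-1) H) _) => m.
by rewrite mulrCA mulVf ?mulr1// mulf_neq0.
Qed.

End Limit.

(** For [m = -n < 0] the term is [(q/z)^n q^(n(n-1)/2)] up to sign, which is why both [z] and
    [q / z] have to be small. *)
Lemma theta_bound (z : C) (rho : R) (m : int) : z != 0 ->
  `|z| <= rho%:C -> `|q / z| <= rho%:C ->
  `|(-1) ^ m * z ^ m * q ^ tri m| <= (1 * rho ^+ `|m|%N)%:C.
Proof.
move=> z0 zr qzr; rewrite mul1r rmorphXn /=.
have powle (x : C) n k : `|x| <= rho%:C -> `|x ^+ n * q ^+ k| <= rho%:C ^+ n.
  move=> xr; rewrite normrM -[leRHS]mulr1 !normrX; apply: ler_pM.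
  - by rewrite exprn_ge0.
  - by rewrite exprn_ge0.
  - by rewrite lerXn2r// nnegrE// (le_trans _ xr).
  - by rewrite exprn_ile1// ltW.
have -> : `|(-1) ^ m * z ^ m * q ^ tri m| = `|z ^ m * q ^ tri m|.
  rewrite -mulrA normrM; suff -> : `|(-1 : C) ^ m| = 1 by rewrite mul1r.
  case: m => n; rewrite ?NegzE -?invr_expz -!exprnP ?normfV normrX normrN1 expr1n//.
  by rewrite invr1.
case: m => n; first exact: powle.
rewrite NegzE -invr_expz (_ : (z ^ n.+1)^-1 * q ^ tri (- n.+1%:Z) =
  (q / z) ^+ n.+1 * q ^+ 'C(n.+1, 2)); first exact: powle.
rewrite -[- n.+1%:Z]/(Negz n) /= binS bin1 -!exprnP addnC exprD exprMn exprVn; ring.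
Qed.

Lemma triple_product (z : C) (rho : R) : 0 <= rho < 1 -> z != 0 ->
  `|z| <= rho%:C -> `|q / z| <= rho%:C ->
  has_sum (fun m => (-1) ^ m * z ^ m * q ^ tri m) (qpochs_inf [:: z; q / z; q] q).
Proof.
move=> rho01 z0 zr qzr.
have thetaN N := @finite_triple_product z N z0.
apply: (@bailey_limit_inv _ 1 rho 0 _ rho01 (fun m => theta_bound m z0 zr qzr)).
  move=> N; refine (has_sum_eq (thetaN N) _) => m.
  by congr (_ * (_ * qinv _ _)); lia.
have -> : (qpoch_inf q q)^-1 * (qpoch_inf q q)^-1 * qpochs_inf [:: z; q / z; q] q =
    qpoch_inf z q * qpoch_inf (q / z) q * (qpoch_inf q q)^-1.
  rewrite /qpochs_inf !big_cons big_nil; field.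
  exact: qpoch_inf_neq0.
apply: cvgM; first by apply: cvgM; exact: qpoch_cvg.
by apply: (@qinv_cvg _ 0%N) => N; lia.
Qed.

End Nome.
End Jacobi.

(** * The Bailey chain as a multiple sum *)

Fixpoint words (M l : nat) : seq (seq nat) :=
  if l is l'.+1 then [seq a :: w | a <- iota 0 M, w <- words M l'] else [:: [::]].

Lemma mem_words (M l : nat) (w : seq nat) :
  (w \in words M l) = (size w == l) && all (fun a => (a < M)%N) w.
Proof.
elim: l w => [|l IH] w; first by case: w.
apply/allpairsP/andP => [[[a w'] /= [aM w'M ->]]|[/eqP]].
  by move: aM w'M; rewrite mem_iota IH /= => -> /andP[/eqP -> ->].
case: w => // a w [wl] /= /andP[aM wM].
by exists (a, w); rewrite mem_iota IH wl eqxx.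
Qed.

Lemma uniq_words (M l : nat) : uniq (words M l).
Proof.
elim: l => // l IH; apply: allpairs_uniq; rewrite ?iota_uniq//.
by move=> [a w] [a' w'] _ _ /= [-> ->].
Qed.

Lemma big_wordsS (V : zmodType) (M l : nat) (F : seq nat -> V) :
  \sum_(w <- words M l.+1) F w =
  \sum_(a < M) \sum_(w <- words M l) F (nat_of_ord a :: w).
Proof.
rewrite big_allpairs_dep /=.
have -> : iota 0 M = index_iota 0 M by rewrite /index_iota subn0.
by rewrite big_mkord.
Qed.

Section Chain.
Variable R : realType.
Local Notation C := R[i].
Variables (q : C) (t : nat).

(** Levels are counted from the inside: the innermost [t] steps have weight [q^(s(s+1))], that is
    [a = q], and the outer ones [q^(s*s)], that is [a = 1]. *)
Fixpoint chain (be : nat -> C) (l N : nat) : C :=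
  if l is l'.+1 then \sum_(s < N.+1)
    q ^+ (s * (s + (l <= t))) * qinv q (N%:Z - s%:Z) * chain be l' s
  else be N.

(* The word [w] lists [n_2, ..., n_r], so that its tails have sums
   [N_1, ..., N_(r-1)]. *)
Fixpoint word_term (be : nat -> C) (N : nat) (w : seq nat) : C :=
  if w is a :: w' then let s := (a + sumn w')%N in
    q ^+ (s * (s + (size w <= t))) * qinv q (N%:Z - s%:Z) * word_term be s w'
  else be N.

Fixpoint word_exp (w : seq nat) : nat :=
  if w is a :: w' then let s := (a + sumn w')%N in
    (s * (s + (size w <= t)) + word_exp w')%N
  else 0%N.

(** Consecutive partial sums differ by one letter, so the inner kernels become the factors
    [1/(q;q)_(n_k)] of the summand; only the outermost kernel still sees [N], as a cut-off. *)
Lemma word_termE (be : nat -> C) (N a : nat) (w : seq nat) :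
  word_term be N (a :: w) = qinv q (N%:Z - (sumn (a :: w))%:Z) *
    q ^+ word_exp (a :: w) * (\prod_(x <- belast a w) qinv q x%:Z) *
    be (last a w).
Proof.
elim: w N a => [|a' w IH] N a.
  by rewrite /= !addn0 big_nil mulr1 [X in X * be _]mulrC.
rewrite [word_term _ _ _]/=.
rewrite -[X in _ * X = _]/(word_term be (a + sumn (a' :: w)) (a' :: w)) IH.
rewrite [belast a _]/= big_cons [last a _]/=.
rewrite -[word_exp [:: a, a' & w]]/((a + sumn (a' :: w)) *
  ((a + sumn (a' :: w)) + (size [:: a, a' & w] <= t)) + word_exp (a' :: w))%N.
rewrite exprD -[sumn [:: a, a' & w]]/(a + sumn (a' :: w))%N.
rewrite (_ : (a + sumn (a' :: w))%:Z - (sumn (a' :: w))%:Z = a%:Z); last by lia.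
rewrite /=; ring.
Qed.

Lemma word_term_lt (be : nat -> C) (N : nat) (w : seq nat) :
  (N < sumn w)%N -> word_term be N w = 0.
Proof.
by case: w => // a w Nw; rewrite word_termE qinv_lt0 ?mul0r//; lia.
Qed.

Lemma chain_words (be : nat -> C) (M l N : nat) : (N < M)%N ->
  \sum_(w <- words M l) word_term be N w = chain be l N.
Proof.
elim: l N => [|l IH] N NM; first by rewrite big_seq1.
rewrite big_wordsS exchange_big /=.
transitivity (\sum_(w <- words M l) \sum_(s < N.+1)
    q ^+ (s * (s + (l < t))) * qinv q (N%:Z - s%:Z) * word_term be s w).
  apply: eq_big_seq => w; rewrite mem_words => /andP[/eqP -> _].
  pose G s := q ^+ (s * (s + (l < t))) * qinv q (N%:Z - s%:Z) * word_term be s w.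
  have G_gt s : (N < s)%N -> G s = 0.
    by move=> Ns; rewrite /G qinv_lt0 ?mulr0 ?mul0r//; lia.
  have G_lt s : (s < sumn w)%N -> G s = 0.
    by move=> sw; rewrite /G word_term_lt ?mulr0.
  rewrite -[LHS]/(\sum_(a < M) G (a + sumn w)%N) -[RHS]/(\sum_(s < N.+1) G s).
  rewrite -(big_mkord xpredT (fun a => G (a + sumn w)%N)) -(big_mkord xpredT G).
  (* The letter [a] is traded for the partial sum [s = a + sumn w]. Both sides extend to this common
     range because [G] vanishes below [sumn w] and above [N]. *)
  transitivity (\sum_(0 <= s < M + sumn w) G s).
    rewrite [RHS](@big_cat_nat _ _ _ (sumn w))//= ?leq_addl// [X in X + _]big_nat.
    rewrite [X in X + _]big1 ?add0r; last by move=> s /andP[_ /G_lt].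
    by rewrite -{2}[sumn w]add0n big_addn addnK.
  rewrite (@big_cat_nat _ _ _ N.+1)//=; last by lia.
  rewrite [X in _ + X]big_nat [X in _ + X]big1 ?addr0// => s /andP[Ns _].
  exact: G_gt.
rewrite exchange_big /=; apply: eq_bigr => s _.
by rewrite -mulr_sumr IH//; have := ltn_ord s; lia.
Qed.

Lemma eq_chain (be be' : nat -> C) (l N : nat) :
  (forall s, (s <= N)%N -> be s = be' s) -> chain be l N = chain be' l N.
Proof.
elim: l N => [|l IH] N bb' /=; first exact: bb'.
apply: eq_bigr => s _; rewrite IH// => s' s's; apply: bb'.
by have := ltn_ord s; lia.
Qed.

Lemma chainZ (c : C) (be : nat -> C) (l N : nat) :
  chain (fun s => be s * c) l N = chain be l N * c.
Proof.
elim: l N => //= l IH N; rewrite mulr_suml; apply: eq_bigr => s _.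
by rewrite IH mulrA.
Qed.

Lemma chain_sum (M : nat) (be : nat -> nat -> C) (l N : nat) :
  chain (fun s => \sum_(k < M) be k s) l N = \sum_(k < M) chain (be k) l N.
Proof.
elim: l N => //= l IH N; rewrite exchange_big /=; apply: eq_bigr => s _.
by rewrite IH mulr_sumr.
Qed.

Hypothesis q0 : q != 0.
Hypothesis q1 : forall n, 1 - q * q ^+ n != 0.

Variables (al : int -> C) (be : nat -> C).
Hypothesis al_be : forall N : nat,
  has_sum (fun m => al m * (qinv q (N%:Z - m) * qinv q (N%:Z + m + 1%:Z))) (be N).

Lemma chain_pair1 (l N : nat) : (l <= t)%N ->
  has_sum (fun m => al m * q ^ (l%:Z * (m * (m + 1))) *
    (qinv q (N%:Z - m) * qinv q (N%:Z + m + 1%:Z))) (chain be l N).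
Proof.
elim: l N => [|l IH] N lt.
  by refine (has_sum_eq (@al_be N) _) => m; rewrite mul0r expr0z mulr1.
have H := bailey_step q0 q1 (leqnn 1) (fun n => IH n (ltnW lt)).
rewrite /= lt; refine (has_sum_eq (@H N) _) => m; congr (_ * _).
rewrite -mulrA -expfzDr//; congr (_ * q ^ _); lia.
Qed.

Hypothesis al_sym : forall m, al (- 1 - m) = - (q ^ (2 * m + 1) * al m).

(* [1/(q)_{N+m} = (1 - q^(N+m+1)) / (q)_{N+m+1}], so the two sums differ by one
   whose terms are odd under [m -> -1-m], a symmetry of the first kernel. *)
Lemma switch_pair (N : nat) (A : int -> C) (S : C) :
  (forall m, A (- 1 - m) = - (q ^ (2 * m + 1) * A m)) ->
  has_sum (fun m => A m * (qinv q (N%:Z - m) * qinv q (N%:Z + m + 1%:Z))) S ->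
  has_sum (fun m => A m * (qinv q (N%:Z - m) * qinv q (N%:Z + m + 0%:Z))) S.
Proof.
move=> A_sym AS.
have H := @has_sum_window _ q (fun m => A m * q ^ (N%:Z + m + 1)) N.*2.+1 N.
move: (\sum_(k < _) _) H => T H.
have T0 : T = 0.
  apply: (@has_sum_antisym _ _ (fun m => - 1 - m) _ _ _ _ H) => [m|m]; first by lia.
  rewrite (_ : N%:Z - (- 1 - m) = N.*2.+1%:Z - N%:Z + m); last by lia.
  rewrite (_ : N.*2.+1%:Z - N%:Z + (- 1 - m) = N%:Z - m); last by lia.
  rewrite (_ : N%:Z + m + 1 = (N%:Z + (- 1 - m) + 1) + (2 * m + 1)); last by lia.
  rewrite A_sym (expfzDr (N%:Z + (- 1 - m) + 1))//; ring.
rewrite T0 in H; have H' := has_sumD AS (has_sumZ (c := -1) H).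
rewrite mulr0 addr0 in H'.
refine (has_sum_eq H' _) => m.
rewrite (_ : N%:Z + m + 0%:Z = N%:Z + m + 1%:Z - 1); last by lia.
rewrite (_ : N.*2.+1%:Z - N%:Z + m = N%:Z + m + 1%:Z); last by lia.
rewrite -[X in _ = _ * (_ * X)](qinv_rec q0 q1); ring.
Qed.

Lemma chain_pair0 (k N : nat) :
  has_sum (fun m => al m * q ^ (t%:Z * (m * (m + 1)) + k%:Z * (m * m)) *
    (qinv q (N%:Z - m) * qinv q (N%:Z + m + 0%:Z))) (chain be (t + k) N).
Proof.
elim: k N => [|k IH] N.
  rewrite addn0.
  have H := @chain_pair1 t N (leqnn t).
  (* The reflection [m -> -1-m] fixes [m(m+1)], so the steps with [a = q] preserve the symmetry of
     alpha. *)
  have sym m : al (- 1 - m) * q ^ (t%:Z * ((- 1 - m) * (- 1 - m + 1))) =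
      - (q ^ (2 * m + 1) * (al m * q ^ (t%:Z * (m * (m + 1))))).
    rewrite al_sym (_ : (- 1 - m) * (- 1 - m + 1) = m * (m + 1)); last by lia.
    ring.
  refine (has_sum_eq (switch_pair sym H) _) => m.
  by rewrite (_ : 0%:Z * (m * m) = 0) ?addr0// mul0r.
have H := bailey_step q0 q1 (leq0n 1) IH.
rewrite addnS /= (_ : (t + k < t)%N = false); last by lia.
refine (has_sum_eq (@H N) _) => m; congr (_ * _).
by rewrite -mulrA -expfzDr//; congr (_ * q ^ _); lia.
Qed.

End Chain.

(** * The quadratic form *)

Lemma sumn_dropE (k : nat) (w : seq nat) :
  sumn (drop k w) = (\sum_(i < size w) (k <= i) * nth 0 w i)%N.
Proof.
elim: w k => [|a w IH] k; first by rewrite big_ord0.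
case: k => [|k]; rewrite big_ord_recl /= ?mul1n ?mul0n ?add0n.
  by rewrite -[w in LHS]drop0 IH.
by rewrite IH; apply: eq_bigr => i _.
Qed.

Lemma word_expE (t : nat) (w : seq nat) : word_exp t w =
  (\sum_(k < size w) sumn (drop k w) * (sumn (drop k w) + (size w - k <= t)))%N.
Proof.
elim: w => [|a w IH]; first by rewrite big_ord0.
by rewrite big_ord_recl /= IH subn0.
Qed.

Lemma sum_ltn (m n : nat) : (m <= n)%N -> (\sum_(k < n) (k < m) = m)%N.
Proof.
elim: n m => [|n IH] m mn; first by rewrite big_ord0; lia.
rewrite big_ord_recr /=; move: mn; rewrite leq_eqVlt => /orP[/eqP ->|mn].
  rewrite ltnSn (eq_bigr (fun=> 1%N)) ?sum_nat_const ?card_ord; first by lia.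
  by move=> i _; rewrite ltnS ltnW.
by rewrite ltnNge -ltnS mn addn0 IH.
Qed.

Section Exponent.
Variables (l n1 : nat) (w : seq nat).
Hypothesis size_w : size w = l.+1.

Definition vec (r : nat) (s : seq nat) : 'cV[nat]_r := \col_(i < r) nth 0%N s i.

Local Notation v := (vec l.+2 (n1 :: w)).
Let x (i : nat) : rat := (nth 0%N (n1 :: w) i)%:R.
Let S (k : nat) : rat := (sumn (drop k w))%:R.

Let SE (k : nat) : S k = \sum_(i < l.+2) (k < i)%N%:R * x i.
Proof.
rewrite /S sumn_dropE size_w [in RHS]big_ord_recl ltn0 mul0r add0r natr_sum.
by apply: eq_bigr => i _; rewrite natrM.
Qed.

Let last_x : (last n1 w)%:R = x l.+1.
Proof. by rewrite /x (last_nth 0%N) size_w. Qed.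

Lemma last_entry_vec : last_entry v = last n1 w.
Proof.
rewrite /last_entry (big_pred1 ord_max) => [|i].
  by rewrite mxE (last_nth 0%N) size_w.
by rewrite /= -val_eqE.
Qed.

Let d (i : nat) : rat := (i == 0)%:R + (i == l.+1)%:R.

Let sum_dx : \sum_(i < l.+2) d i * x i = (n1 + last n1 w)%:R.
Proof.
have d0 : d 0 = 1 by rewrite /d /= addr0.
have dl : d l.+1 = 1 by rewrite /d /= eqxx add0r.
rewrite natrD last_x big_ord_recl big_ord_recr /= big1 => [|i _].
  by rewrite /bump /= add1n d0 dl !mul1r add0r.
rewrite /d /= /bump /=; have := ltn_ord i; case: eqP => [|_ _]; first by lia.
by rewrite addr0 mul0r.
Qed.

(** A decomposition into rank-one squares: the indicator vectors of the tails give the partial sums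
    [N_k], and [d], supported on the first and last index, gives [n_1 + n_r]. Counting [k] below
    both 0-based indices yields their minimum. *)
Let BDmxE (i j : 'I_l.+2) : BDmx l.+2 i j =
  2 * \sum_(k < l.+1) ((k < i)%N%:R * (k < j)%N%:R) + d i * d j.
Proof.
have -> : \sum_(k < l.+1) ((k < i)%N%:R * (k < j)%N%:R) = (minn i j)%:R :> rat.
  rewrite -[minn i j](@sum_ltn _ l.+1); last by have := ltn_ord i; lia.
  rewrite natr_sum; apply: eq_bigr => k _.
  by rewrite -natrM mulnb leq_min.
rewrite mxE /d /=; move: (ltn_ord i) (ltn_ord j).
move: (nat_of_ord i) (nat_of_ord j) => {}i {}j il jl.
rewrite !eqSS !ltnS minnSS -[(minn i j).+1%:R]natr1 addrK.
case: i il => [|i] il; case: j jl => [|j] jl; rewrite ?eqSS ?min0n ?minn0 /=.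
- by [].
- by case: eqP => _; rewrite ?mulr0 ?add0r ?addr0 ?mulr1 ?mulr0.
- by case: eqP => _; rewrite ?mulr0 ?add0r ?addr0 ?mulr1 ?mulr0.
- rewrite !add0r; case: eqP => [->|_] /=; last by rewrite mul0r addr0.
  case: eqP => [->|_] /=; last by rewrite mulr0 addr0.
  by rewrite minnn -[l.+2%:R]natr1; ring.
Qed.

Let N : 'cV[rat]_l.+2 := map_mx (fun k : nat => k%:R) v.

Let NE i : N i 0 = x i. Proof. by rewrite !mxE. Qed.

Let quadE : (N^T *m BDmx l.+2 *m N) 0 0 =
  2 * \sum_(k < l.+1) S k ^+ 2 + (n1 + last n1 w)%:R ^+ 2.
Proof.
rewrite mxE.
transitivity (\sum_(j < l.+2) \sum_(i < l.+2)
    (2 * \sum_(k < l.+1) (((k < i)%N%:R * x i) * ((k < j)%N%:R * x j)) +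
     (d i * x i) * (d j * x j))).
  apply: eq_bigr => j _; rewrite mxE mulr_suml; apply: eq_bigr => i _.
  rewrite mxE NE BDmxE NE mulrDr mulrDl; congr (_ + _); last by ring.
  rewrite mulrCA -mulrA; congr (_ * _); rewrite mulr_sumr mulr_suml.
  by apply: eq_bigr => k _; ring.
under eq_bigr do rewrite big_split /=.
rewrite big_split /=; congr (_ + _).
  under eq_bigr do rewrite -mulr_sumr.
  rewrite -mulr_sumr; congr (_ * _).
  transitivity (\sum_(j < l.+2) \sum_(k < l.+1) \sum_(i < l.+2)
      (((k < i)%N%:R * x i) * ((k < j)%N%:R * x j))).
    by apply: eq_bigr => j _; rewrite exchange_big.
  rewrite exchange_big /=; apply: eq_bigr => k _.
  rewrite expr2 {2}SE mulr_sumr; apply: eq_bigr => j _.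
  by rewrite SE mulr_suml.
rewrite -sum_dx expr2 mulr_sumr; apply: eq_bigr => j _.
by rewrite mulr_suml.
Qed.

Let linE (b : 'cV[rat]_l.+2) : (N^T *m b) 0 0 = \sum_(i < l.+2) x i * b i 0.
Proof. by rewrite mxE; apply: eq_bigr => i _; rewrite mxE NE. Qed.

Let word_expS (t : nat) : (word_exp t w)%:R =
  \sum_(k < l.+1) S k ^+ 2 + \sum_(k < l.+1) (l.+1 - k <= t)%N%:R * S k.
Proof.
rewrite word_expE size_w natr_sum -big_split; apply: eq_bigr => k _ /=.
by rewrite natrM natrD mulrDr -expr2 [X in _ + X]mulrC.
Qed.

Lemma qexponent_b0 : qexponent (b0vec l.+2) v =
  ((n1 + last n1 w) ^ 2 + n1.*2 + (word_exp l.+1 w).*2)%N%:R / 2.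
Proof.
rewrite /qexponent -/N mxE [X in X + _]mxE quadE linE.
(* Beyond the first entry, [b0vec] counts the partial sums that contain the given letter. *)
have -> : \sum_(i < l.+2) x i * b0vec l.+2 i 0 = n1%:R + \sum_(k < l.+1) S k.
  rewrite [in LHS]big_ord_recl mxE /= mulr1; congr (_ + _).
  under [RHS]eq_bigr do rewrite SE.
  rewrite exchange_big /= [in RHS]big_ord_recl [X in _ = X + _]big1 ?add0r; last first.
    by move=> k _; rewrite ltn0 mul0r.
  apply: eq_bigr => i _; rewrite mxE /= -mulr_suml mulrC; congr (_ * _).
  rewrite -natr_sum sum_ltn; last by have := ltn_ord i; rewrite /bump /=; lia.
  by rewrite /bump /= add1n -[i.+2%:R]natr1 addrK.
rewrite !natrD natrX -!muln2 !natrM word_expS.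
have -> : \sum_(k < l.+1) (l.+1 - k <= l.+1)%N%:R * S k = \sum_(k < l.+1) S k.
  by apply: eq_bigr => k _; rewrite leq_subr mul1r.
by field.
Qed.

Lemma qexponent_b (j : nat) : (1 <= j <= l.+2)%N ->
  qexponent (bvec l.+2 j) v =
  (((n1 + last n1 w) ^ 2 + (word_exp (l.+2 - j) w).*2)%N%:R -
    (last n1 w).*2%:R) / 2.
Proof.
move=> jl; rewrite /qexponent -/N mxE [X in X + _]mxE quadE linE.
have cE (i : nat) : (i <= l.+1)%N ->
    \sum_(k < l.+1) (l.+1 - k <= l.+2 - j)%N%:R * ((k < i)%N%:R * x i) =
    (i.+1 - j)%N%:R * x i.
  move=> il; under eq_bigr do rewrite mulrA -natrM mulnb.
  rewrite -mulr_suml -natr_sum; congr (_%:R * _).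
  (* The level condition says [j.-1 <= k]. Its complement below [i] is [k < minn i j.-1], and both
     remaining counts are instances of [sum_ltn]. *)
  have : (\sum_(k < l.+1) ((l.+1 - k <= l.+2 - j) && (k < i)) +
      \sum_(k < l.+1) (k < minn i j.-1) = \sum_(k < l.+1) (k < i))%N.
    rewrite -big_split; apply: eq_bigr => k _ /=.
    by have := ltn_ord k; rewrite leq_min; lia.
  rewrite (@sum_ltn (minn i j.-1)) ?(@sum_ltn i)//; last by lia.
  by move=> H; apply: (@addIn (minn i j.-1)); rewrite H; lia.
(* The last entry of [bvec] is one less than the pattern of the others, hence the extra [- n_r]. *)
have -> : \sum_(i < l.+2) x i * bvec l.+2 j i 0 =
    \sum_(k < l.+1) (l.+1 - k <= l.+2 - j)%N%:R * S k - (last n1 w)%:R.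
  under [in RHS]eq_bigr do rewrite SE mulr_sumr.
  rewrite exchange_big /= [in RHS]big_ord_recr /= [in LHS]big_ord_recr /= -addrA.
  congr (_ + _).
    apply: eq_bigr => i _; have il := ltn_ord i; rewrite cE; last by lia.
    rewrite mxE /= (_ : (i.+1 == l.+2) = false); last by lia.
    rewrite mulrC; congr (_ * _); have [ij|ji] := leqP j i.+1.
      by rewrite natrB// max_l// subr_ge0 ler_nat.
    rewrite max_r; last by rewrite subr_le0 ler_nat ltnW.
    by rewrite (_ : i.+1 - j = 0)%N//; lia.
  rewrite cE// mxE /= eqxx last_x natrB; last by lia.
  ring.
rewrite !natrD natrX -!muln2 !natrM word_expS; by field.
Qed.

End Exponent.

(** * Evaluation of the limit *)

Section QPow.
Variable R : realType.
Local Notation C := R[i].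

Lemma cexpD (a b : C) : cexp (a + b) = cexp a * cexp b.
Proof.
case: a b => [a1 a2] [b1 b2]; rewrite /cexp /= expRD rmorphM /= mulrACA.
by congr (_ * _); rewrite cosD sinD; simpc; congr (_ +i* _); ring.
Qed.

Lemma norm_cexp (a : C) : `|cexp a| = (expR (complex.Re a))%:C.
Proof.
rewrite /cexp normrM !normc_def /= expr0n addr0 cos2Dsin2 sqrtr1 mulr1.
by rewrite sqrtr_sqr ger0_norm ?expR_ge0.
Qed.

Lemma qpowD (tau : C) (x y : rat) : qpow tau (x + y) = qpow tau x * qpow tau y.
Proof. by rewrite /qpow rmorphD mulrDr mulrDl cexpD. Qed.

Lemma qpow0 (tau : C) : qpow tau 0 = 1.
Proof.
rewrite /qpow rmorph0 mulr0 mul0r /cexp /= expR0 cos0 sin0.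
by rewrite complexr0 mulr1.
Qed.

Lemma qpow_neq0 (tau : C) (x : rat) : qpow tau x != 0.
Proof.
apply/eqP => x0; have := qpowD tau x (- x).
by rewrite subrr qpow0 x0 mul0r => /eqP; rewrite oner_eq0.
Qed.

Lemma qpow_half (tau : C) (n : nat) : qpow tau (n%:R / 2) = qpow tau (1 / 2) ^+ n.
Proof.
elim: n => [|n IH]; first by rewrite mul0r qpow0 expr0.
by rewrite exprS -IH -qpowD; congr qpow; rewrite -natr1; field.
Qed.

Lemma qpow_half_lt1 (tau : C) : 0 < complex.Im tau -> `|qpow tau (1 / 2)| < 1.
Proof.
case: tau => a b /= b0; rewrite /qpow norm_cexp.
have -> : ratr (1 / 2) = ((1 / 2 : R))%:C :> C.
  by rewrite !fmorph_div /= !rmorph1 !rmorph_nat.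
set z := (X in complex.Re X); suff : expR (complex.Re z) < 1 by rewrite -ltcR.
rewrite -expR0 ltr_expR /z /=. 
rewrite (_ : _ - _ = - (pi * b)); last by field.
by rewrite oppr_lt0 mulr_gt0// pi_gt0.
Qed.

End QPow.

Section QPochInf.
Variable R : realType.
Local Notation C := R[i].

Lemma qpoch_inf_double (a b : C) : `|b| < 1 ->
  qpoch_inf a (b ^+ 2) * qpoch_inf (a * b) (b ^+ 2) = qpoch_inf a b.
Proof.
move=> b1; have b21 : `|b ^+ 2| < 1 by rewrite normrX exprn_ilt1.
have E n : qpoch a (b ^+ 2) n * qpoch (a * b) (b ^+ 2) n = qpoch a b n.*2.
  elim: n => [|n IH]; first by rewrite !qpoch0 mulr1.
  by rewrite doubleS !qpochS -IH (exprS b n.*2) -!exprM mul2n; ring.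
have L : qpoch a b n.*2 @[n --> \oo] --> qpoch_inf a b.
  apply: (@cvg_shift _ _ _ (fun n => n.*2) 0 _ (@qpoch_cvg _ _ b1 a)) => n.
  by lia.
have L' : qpoch a b n.*2 @[n --> \oo] -->
    qpoch_inf a (b ^+ 2) * qpoch_inf (a * b) (b ^+ 2).
  under eq_cvg do rewrite -E.
  exact: (cvgM (@qpoch_cvg _ _ b21 a) (@qpoch_cvg _ _ b21 (a * b))).
exact: (cvg_unique _ L' L).
Qed.

Lemma qpoch_inf_sqr (a b : C) : `|b| < 1 ->
  qpoch_inf a b * qpoch_inf (- a) b = qpoch_inf (a ^+ 2) (b ^+ 2).
Proof.
move=> b1; have b21 : `|b ^+ 2| < 1 by rewrite normrX exprn_ilt1.
have E n : qpoch (a ^+ 2) (b ^+ 2) n = qpoch a b n * qpoch (- a) b n.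
  elim: n => [|n IH]; first by rewrite !qpoch0 mulr1.
  by rewrite !qpochS IH -exprM mulnC exprM; ring.
have L : qpoch (a ^+ 2) (b ^+ 2) n @[n --> \oo] -->
    qpoch_inf a b * qpoch_inf (- a) b.
  under eq_cvg do rewrite E.
  exact: (cvgM (@qpoch_cvg _ _ b1 a) (@qpoch_cvg _ _ b1 (- a))).
exact: (cvg_unique _ L (@qpoch_cvg _ _ b21 (a ^+ 2))).
Qed.

Lemma qpoch_inf_rec (a b : C) : `|b| < 1 ->
  qpoch_inf a b = (1 - a) * qpoch_inf (a * b) b.
Proof.
move=> b1.
have L : qpoch a b n.+1 @[n --> \oo] --> qpoch_inf a b.
  by apply: (@cvg_shift _ _ _ (fun n => n.+1) 0 _ (@qpoch_cvg _ _ b1 a)) => n; lia.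
have L' : qpoch a b n.+1 @[n --> \oo] --> (1 - a) * qpoch_inf (a * b) b.
  under eq_cvg => n do rewrite -(add1n n) qpochD qpochS qpoch0 mul1r expr0 mulr1 expr1.
  exact: (cvgM (cvg_cst _) (@qpoch_cvg _ _ b1 (a * b))).
exact: (cvg_unique _ L L').
Qed.

End QPochInf.

Section Limits.
Variable R : realType.
Local Notation C := R[i].
Variable p : C.
Hypothesis p0 : p != 0.
Hypothesis p1 : `|p| < 1.
Local Notation q := (p ^+ 2).
Let q0 : q != 0. Proof. by rewrite expf_neq0. Qed.
Let qlt1 : `|q| < 1. Proof. by rewrite normrX exprn_ilt1. Qed.
Let q1 n : 1 - q * q ^+ n != 0. Proof. exact: qfactor_neq0. Qed.
Let rho := complex.Re `|p|.
Let rhoE : `|p| = rho%:C. Proof. by rewrite RRe_real// normr_real. Qed.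
Let rho01 : 0 <= rho < 1.
Proof. by rewrite -lecR -ltcR -rhoE normr_ge0. Qed.
Local Notation w := (qpoch_inf q q)^-1.

Let pexp_le (n : nat) : `|p ^+ n.+1| <= rho%:C.
Proof.
by rewrite normrX -rhoE exprS ler_piMr// exprn_ile1// ltW.
Qed.

(** Exponents are doubled, being powers of [p]: the modulus [2r - 3/2] of the theorem becomes
    [D = 4(r-1) + 1]. *)
Definition theta (D e : nat) : C :=
  qpochs_inf [:: p ^+ e; p ^+ (D - e); p ^+ D] (p ^+ D).

Section Theta.
Variables (D e : nat).
Hypothesis eD : (0 < e < D)%N.
Let al (m : int) : C := (-1) ^ m * (p ^+ (D - e)) ^ m * (p ^+ D) ^ tri m.

Let divE : p ^+ D / p ^+ (D - e) = p ^+ e.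
Proof.
have -> : D = (e + (D - e))%N by lia.
by rewrite addKn exprD mulfK// expf_neq0.
Qed.

Let al_bound m : `|al m| <= (1 * rho ^+ `|m|%N)%:C.
Proof.
apply: theta_bound; rewrite ?expf_neq0 ?divE//.
- by rewrite normrX exprn_ilt1//; lia.
- by have -> : (D - e = (D - e).-1.+1)%N by lia.
- by have -> : (e = e.-1.+1)%N by lia.
Qed.

Let al_sum : has_sum al (theta D e).
Proof.
have pD1 : `|p ^+ D| < 1 by rewrite normrX exprn_ilt1//; lia.
have -> : theta D e =
    qpochs_inf [:: p ^+ (D - e); p ^+ D / p ^+ (D - e); p ^+ D] (p ^+ D).
  by rewrite divE /theta /qpochs_inf !big_cons; ring.
apply: (triple_product _ pD1 rho01); rewrite ?expf_neq0 ?divE//.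
- by have -> : (D - e = (D - e).-1.+1)%N by lia.
- by have -> : (e = e.-1.+1)%N by lia.
Qed.

Lemma theta_limit (c : nat) (E : int -> int) (be : nat -> C) :
  (forall m, E m = (D - e)%N%:Z * m + D%:Z * tri m) ->
  (forall N : nat, has_sum (fun m => (-1) ^ m * p ^ E m *
    (qinv q (N%:Z - m) * qinv q (N%:Z + m + c%:Z))) (be N)) ->
  be N @[N --> \oo] --> theta D e * (w * w).
Proof.
move=> EE beE.
have alE N : has_sum (fun m => al m * (qinv q (N%:Z - m) * qinv q (N%:Z + m + c%:Z)))
    (be N).
  refine (has_sum_eq (@beE N) _) => m; congr (_ * _).
  by rewrite /al !(exprnP p) !exprz_exp -mulrA -expfzDr// EE.
exact: (bailey_limit q0 qlt1 rho01 al_bound alE al_sum).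
Qed.

End Theta.

(** The beta of [base_pair0] for [b = false] and of [base_pair1] for [b = true]. *)
Definition chain_base (b : bool) (s : nat) : C :=
  (-1) ^+ s * p ^ (s%:Z * s%:Z - (~~ b).*2%:Z * s%:Z) /
    (qpoch (- p ^+ (1 + b.*2)) q s * qpoch (q ^+ 2) (q ^+ 2) s).

Lemma chain_limit0 (t k : nat) : (0 < t + k)%N ->
  chain q t (chain_base false) (t + k) N @[N --> \oo] -->
    theta (4 * (t + k) + 1) (2 * k.+1) * (w * w).
Proof.
move=> tk0; apply: (@theta_limit _ _ _ 0
  (fun m => tri m - m + 2 * (t%:Z * (m * (m + 1)) + k%:Z * (m * m)))).
- by lia.
(* With [m(m+1) = 2 tri m + 2m] and [m*m = 2 tri m + m], the quadratic part is [(4(t+k)+1) tri m]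
   and the linear one [(4t+2k-1) m], so [e = 2(k+1)]. *)
- by move=> m; have := tri_double m; lia.
move=> N.
have base n := @base_pair0 _ p p0 p1 n.
have sym m : (-1) ^ (- 1 - m) * p ^ (tri (- 1 - m) - (- 1 - m)) =
    - (q ^ (2 * m + 1) * ((-1) ^ m * p ^ (tri m - m))).
  rewrite (_ : tri (- 1 - m) - (- 1 - m) = 2 * (2 * m + 1) + (tri m - m)); last first.
    by have := tri_double m; have := tri_double (- 1 - m); lia.
  have N10 : (-1 : C) != 0 by rewrite oppr_eq0 oner_eq0.
  rewrite !(expfzDr _ _ N10) expfzDr// (exprnP p) exprz_exp.
  have -> : (-1 : C) ^ (- m) = (-1) ^ m by rewrite -exprz_inv invrN1.
  by rewrite exprN1 invrN1; ring.
have H := @chain_pair0 _ q t q0 q1 _ _ base sym k N.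
have -> : chain q t (chain_base false) (t + k) N = chain q t (fun n =>
    (-1) ^+ n * p ^ (n%:Z * n%:Z - 2 * n%:Z) /
      (qpoch (- p) q n * qpoch (q ^+ 2) (q ^+ 2) n)) (t + k) N by [].
refine (has_sum_eq H _) => m; congr (_ * _).
by rewrite -mulrA (exprnP p) exprz_exp -expfzDr.
Qed.

Lemma chain_limit1 (t : nat) : (0 < t)%N ->
  chain q t (chain_base true) t N @[N --> \oo] -->
    (1 + p) * (theta (4 * t + 1) 1 * (w * w)).
Proof.
move=> t0.
have p10 : 1 + p != 0.
  have := @qfactor_neq0 _ _ p1 (- p) 0.
  by rewrite normrN expr0 mulr1 opprK; exact.
have base n := @base_pair1 _ p p0 p1 n.
have H N := has_sumZ (c := (1 + p)^-1) (@chain_pair1 _ q t q0 q1 _ _ base t N (leqnn t)).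
(* The constant [1 + p] in the alpha of [base_pair1] is divided out to leave a pure theta series. *)
have L : (1 + p)^-1 * chain q t (chain_base true) t N @[N --> \oo] -->
    theta (4 * t + 1) 1 * (w * w).
  apply: (@theta_limit _ _ _ 1 (fun m => tri m + 2 * (t%:Z * (m * (m + 1))))).
  - by lia.
  - by move=> m; have := tri_double m; lia.
  move=> N.
  have -> : chain q t (chain_base true) t N = chain q t (fun n =>
      (-1) ^+ n * p ^ (n%:Z * n%:Z) /
        (qpoch (- p ^+ 3) q n * qpoch (q ^+ 2) (q ^+ 2) n)) t N.
    by apply: eq_chain => s _; rewrite /chain_base mul0r subr0.
  refine (has_sum_eq (H N) _) => m.
  rewrite -!(mulrA (1 + p)) (mulKf p10); congr (_ * _).
  by rewrite -mulrA (exprnP p) exprz_exp -expfzDr.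
have -> : (fun N => chain q t (chain_base true) t N) =
    (fun N => (1 + p) * ((1 + p)^-1 * chain q t (chain_base true) t N)).
  by apply/funext => N; rewrite mulVKf.
exact: (cvgM (cvg_cst _) L).
Qed.

(** Merging residues modulo 2 gives [(p,p^3;q^2) = (p;q)]; then [(p;q)(-p;q) = (q;q^2)], and
    [(q;q^2)(q^2;q^2) = (q;q)], all products being infinite. *)
Lemma denominatorE :
  qpochs_inf [:: p; p ^+ 3; q ^+ 2] (q ^+ 2) * qpoch_inf (- p) q = qpoch_inf q q.
Proof.
have h1 := @qpoch_inf_double _ q q qlt1.
have h2 := @qpoch_inf_sqr _ p q qlt1.
have h3 := @qpoch_inf_double _ p q qlt1.
have e1 : q * q = q ^+ 2 by [].
have e2 : p * q = p ^+ 3 by rewrite -exprS.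
rewrite e1 in h1; rewrite e2 in h3; rewrite /qpochs_inf !big_cons big_nil mulr1.
move: (qpoch_inf p (q ^+ 2)) (qpoch_inf (p ^+ 3) (q ^+ 2)) h1 h2 h3.
move: (qpoch_inf (q ^+ 2) (q ^+ 2)) (qpoch_inf q (q ^+ 2)) (qpoch_inf q q).
move: (qpoch_inf p q) (qpoch_inf (- p) q) => A B D E F X Y <- <- <-.
ring.
Qed.

End Limits.

(** * Passage to the limit *)

Definition unvec (r : nat) (v : 'cV[nat]_r) : seq nat := [seq v i 0 | i <- enum 'I_r].

Lemma size_unvec (r : nat) (v : 'cV[nat]_r) : size (unvec v) = r.
Proof. by rewrite size_map size_enum_ord. Qed.

Lemma unvecK (r : nat) : cancel (@unvec r) (vec r).
Proof.
move=> v; apply/matrixP => i j; rewrite mxE (ord1 j) (nth_map i) ?size_enum_ord//.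
by rewrite nth_ord_enum.
Qed.

Lemma vecK (r : nat) (s : seq nat) : size s = r -> unvec (vec r s) = s.
Proof.
move=> sr; apply: (@eq_from_nth _ 0%N); rewrite size_unvec// => i ir.
by rewrite (nth_map (Ordinal ir)) ?size_enum_ord// mxE nth_enum_ord.
Qed.

Lemma leq_sumn_mem (a : nat) (w : seq nat) : a \in w -> (a <= sumn w)%N.
Proof.
elim: w => // b w IH; rewrite inE => /orP[/eqP <- /=|/IH /=]; lia.
Qed.

Lemma uniq_vec_words (M r : nat) : uniq [seq vec r w | w <- words M r].
Proof.
rewrite map_inj_in_uniq ?uniq_words// => s s'; rewrite !mem_words.
by move=> /andP[/eqP sr _] /andP[/eqP s'r _] /(congr1 (@unvec r)); rewrite !vecK.
Qed.

Lemma mem_vec_words (M r : nat) (v : 'cV[nat]_r) :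
  (v \in [seq vec r w | w <- words M r]) = all (fun a => (a < M)%N) (unvec v).
Proof.
apply/mapP/idP => [[w]|vM].
  by rewrite mem_words => /andP[/eqP wr wM] ->; rewrite vecK.
by exists (unvec v); rewrite ?unvecK// mem_words size_unvec eqxx.
Qed.

Section Bound.
Variable R : realType.

Lemma vec_geometric_bound (r : nat) (K rho : R) : 0 <= K -> 0 <= rho < 1 ->
  forall A : {fset 'cV[nat]_r},
    \sum_(v <- A) K * rho ^+ sumn (unvec v) <= K * ((1 - rho)^-1) ^+ r.
Proof.
move=> K0 /[dup] rho01 /andP[rho0 rho1].
have r1 : 0 <= (1 - rho)^-1 by rewrite invr_ge0 subr_ge0 ltW.
apply: (@bounded_by_exhaustion _ _ _ (fun N => [seq vec r w | w <- words N r])).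
- by move=> v; rewrite mulr_ge0// exprn_ge0.
- by move=> N; exact: uniq_vec_words.
- move=> A; exists (\max_(v <- A) \max_(a <- unvec v) a).+1 => v vA.
  rewrite mem_vec_words; apply/allP => a av; rewrite ltnS.
  apply: (@leq_trans (\max_(a <- unvec v) a)); first exact: leq_bigmax_seq.
  exact: (leq_bigmax_seq (F := fun v => \max_(a <- unvec v) a)).
- move=> N; rewrite big_map -mulr_sumr ler_wpM2l//.
  have -> : \sum_(w <- words N r) rho ^+ sumn (unvec (vec r w)) =
      \sum_(w <- words N r) rho ^+ sumn w.
    by apply: eq_big_seq => w; rewrite mem_words => /andP[/eqP wr _]; rewrite vecK.
  elim: r => [|r IH]; first by rewrite big_seq1.
  rewrite big_wordsS.
  under eq_bigr => a _ do under eq_bigr => w _ do rewrite /= exprD.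
  under eq_bigr do rewrite -mulr_sumr.
  rewrite -mulr_suml exprS; apply: ler_pM => //.
  + by apply: sumr_ge0 => a _; rewrite exprn_ge0.
  + by apply: sumr_ge0 => a _; rewrite exprn_ge0.
  + exact: geometric_bound.
Qed.

End Bound.

(** * The cut-off multisum, its evaluation and its limit *)

Section Core.
Variable R : realType.
Local Notation C := R[i].
Variables (tau : C) (l t : nat) (b : bool) (bv : 'cV[rat]_l.+2).
Hypothesis tau_gt0 : 0 < complex.Im tau.
Local Notation p := (qpow tau (1 / 2)).
Local Notation q := (p ^+ 2).

(** The exponent of [p], twice that of [q], and so an integer in both parts. *)
Definition exponent (n1 : nat) (w : seq nat) : int :=
  ((n1 + last n1 w) ^ 2 + b.*2 * n1 + (word_exp t w).*2)%N%:Z -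
  (~~ b).*2%:Z * (last n1 w)%:Z.

Hypothesis expE : forall n1 w, size w = l.+1 ->
  qpow tau (qexponent bv (vec l.+2 (n1 :: w))) = p ^ exponent n1 w.

Let p0 : p != 0. Proof. exact: qpow_neq0. Qed.
Let p1 : `|p| < 1. Proof. exact: qpow_half_lt1. Qed.
Let q0 : q != 0. Proof. by rewrite expf_neq0. Qed.
Let qlt1 : `|q| < 1. Proof. by rewrite normrX exprn_ilt1. Qed.
Let q2lt1 : `|q ^+ 2| < 1. Proof. by rewrite normrX exprn_ilt1. Qed.
Let q1 n : 1 - q * q ^+ n != 0. Proof. exact: qfactor_neq0. Qed.
Let rho := complex.Re `|p|.
Let rhoE : `|p| = rho%:C. Proof. by rewrite RRe_real// normr_real. Qed.
Let rho01 : 0 <= rho < 1.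
Proof. by rewrite -lecR -ltcR -rhoE normr_ge0. Qed.

Let qE : qpow tau 1 = q.
Proof. by rewrite -qpow_half; congr qpow. Qed.

Lemma summandE (n1 : nat) (w : seq nat) : size w = l.+1 ->
  summand tau bv (vec l.+2 (n1 :: w)) =
  (-1) ^+ last n1 w * p ^ exponent n1 w *
  (\prod_(x <- belast n1 w) qinv q x%:Z) / qpoch (q ^+ 2) (q ^+ 2) (last n1 w).
Proof.
move=> wl; rewrite /summand last_entry_vec// expE// qE invfM mulrA; congr (_ * _ * _).
rewrite -prodfV big_mkcond big_ord_recr /= ltnn mulr1.
rewrite (big_nth 0%N) size_belast wl big_mkord; apply: eq_bigr => i _.
rewrite !ltnS leq_ord /= mxE /= /qinv; congr (qpoch _ _ _)^-1.
by rewrite (lastI n1 w) nth_rcons size_belast wl ltn_ord.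
Qed.

(** All factors of the cut-off summand that involve [n_1] or [s = n_r], apart from the chain
    weights. If [s > N], the truncated [N - s] is harmless, as the [qinv] beside it is 0. *)
Let base (N n1 s : nat) : C :=
  (-1) ^+ s * p ^ (((n1 + s) ^ 2 + b.*2 * n1)%N%:Z - (~~ b).*2%:Z * s%:Z) *
  qinv q n1 / qpoch (q ^+ 2) (q ^+ 2) s *
  (qpoch q q (N - s) * qinv q (N%:Z - s%:Z - n1%:Z)).

Let F (N : nat) (v : 'cV[nat]_l.+2) : C :=
  word_term q t (base N (head 0%N (unvec v))) N (behead (unvec v)).

Let FE (N n1 : nat) (w : seq nat) : size w = l.+1 ->
  F N (vec l.+2 (n1 :: w)) =
  qinv q (N%:Z - (sumn w)%:Z) *
  (qpoch q q (N - last n1 w) * qinv q (N%:Z - (last n1 w)%:Z - n1%:Z)) *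
  summand tau bv (vec l.+2 (n1 :: w)).
Proof.
move=> wl; rewrite summandE// /F vecK/= ?wl//.
case: w wl => // a w wl; rewrite word_termE /base [last n1 _]/= [belast n1 _]/= big_cons.
have -> : exponent n1 (a :: w) =
    (((n1 + last a w) ^ 2 + b.*2 * n1)%N%:Z - (~~ b).*2%:Z * (last a w)%:Z) +
    (2 * word_exp t (a :: w))%N%:Z.
  rewrite /exponent [last n1 _]/=; clear; lia.
rewrite (expfzDr _ (2 * word_exp t (a :: w))%N%:Z p0) -exprnP exprM; ring.
Qed.

(** With [x = -p^(1+2b)], the q-binomial theorem at [x q^s] produces
    [(x q^s;q)_(N-s) = (x;q)_N / (x;q)_s]: the denominator completes the beta of the Bailey pair,
    and the numerator does not depend on [s]. *)
Let N1_sum (N s : nat) : (s <= N)%N ->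
  \sum_(n1 < N.+1) base N n1 s =
  chain_base p b s * qpoch (- p ^+ (1 + b.*2)) q N.
Proof.
move=> sN; have [M ->] : exists M, N = (M + s)%N by exists (N - s)%N; rewrite subnK.
rewrite (_ : (M + s).+1 = M.+1 + s)%N// big_split_ord /= [X in _ + X]big1; last first.
  by move=> i _; rewrite /base [qinv _ (_ - (M.+1 + i)%:Z)]qinv_lt0 ?mulr0//; clear; lia.
rewrite addr0 addnC qpochD.
have x1 : `|- p ^+ (1 + b.*2)| < 1 by rewrite normrN normrX exprn_ilt1.
have A0 : qpoch (- p ^+ (1 + b.*2)) q s != 0 by exact: qpoch_neq0.
have -> : qpoch (- p ^+ (1 + b.*2) * q ^+ s) q M =
    qpoch q q M * gsum q q (- p ^+ (1 + b.*2) * q ^+ s) M.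
  by rewrite gauss_binomial// /qinv mulrCA mulfV ?mulr1// qpoch_qq_neq0.
transitivity ((-1) ^+ s * p ^ (s%:Z * s%:Z - (~~ b).*2%:Z * s%:Z) /
    qpoch (q ^+ 2) (q ^+ 2) s *
    (qpoch q q M * gsum q q (- p ^+ (1 + b.*2) * q ^+ s) M)).
  rewrite /gsum !mulr_sumr; apply: eq_bigr => k _; rewrite /base addKn.
  rewrite (_ : (s + M)%:Z - s%:Z - k%:Z = M%:Z - k%:Z); last by clear; lia.
  rewrite mulNr opprK.
  have -> : p ^ (((k + s) ^ 2 + b.*2 * k)%N%:Z - (~~ b).*2%:Z * s%:Z) =
      p ^ (s%:Z * s%:Z - (~~ b).*2%:Z * s%:Z) *
      ((p ^+ (1 + b.*2) * q ^+ s) ^+ k * q ^+ 'C(k, 2)).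
    rewrite -!exprM -exprD -exprM -exprD exprnP -expfzDr//; congr (p ^ _).
    by have := bin2_double k; clear; lia.
  ring.
rewrite /chain_base.
have B0 : qpoch (q ^+ 2) (q ^+ 2) s != 0 by exact: qpoch_neq0.
move: (qpoch (- p ^+ (1 + b.*2)) q s) (qpoch (q ^+ 2) (q ^+ 2) s) A0 B0.
move: (qpoch q q M) (gsum _ _ _ _) ((-1) ^+ s) (p ^ _) => x1' x2 x3 x4 A B A0 B0.
by field; rewrite A0 B0.
Qed.

Let F_sum (N : nat) : has_sum (F N)
  (chain q t (chain_base p b) l.+1 N * qpoch (- p ^+ (1 + b.*2)) q N).
Proof.
have F_out v : v \notin [seq vec l.+2 w | w <- words N.+1 l.+2] -> F N v = 0.
  rewrite mem_vec_words -[in F N v](unvecK v); move: (size_unvec v).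
  case: (unvec v) => // n1 w [wl] /=; rewrite negb_and => h; rewrite FE//.
  case/orP: h => [n1N|/allPn[a aw aN]].
    by rewrite [qinv _ (_ - n1%:Z)]qinv_lt0 ?mulr0 ?mul0r//; clear -n1N; lia.
  rewrite [qinv _ (_ - (sumn w)%:Z)]qinv_lt0 ?mul0r//.
  by have := leq_sumn_mem aw; clear -aN; lia.
have := has_sum_finite (uniq_vec_words N.+1 l.+2) F_out.
rewrite big_map.
have -> : \sum_(w <- words N.+1 l.+2) F N (vec l.+2 w) =
    chain q t (chain_base p b) l.+1 N * qpoch (- p ^+ (1 + b.*2)) q N.
  rewrite big_wordsS -chainZ.
  rewrite (@eq_chain _ _ _ _ (fun s => \sum_(n1 < N.+1) base N n1 s)); last first.
    by move=> s sN; rewrite N1_sum.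
  rewrite chain_sum; apply: eq_bigr => n1 _; rewrite -(@chain_words _ _ _ _ N.+1)//.
  by apply: eq_big_seq => w; rewrite mem_words => /andP[/eqP wl _];
    rewrite /F vecK/= ?wl.
exact.
Qed.

(** The cut-off in [n_1] tends to 1, while that in [N_1] tends to [1/(q;q)_oo]; [has_sum_summand]
    multiplies this constant away. *)
Let F_cvg (v : 'cV[nat]_l.+2) :
  F N v @[N --> \oo] --> (qpoch_inf q q)^-1 * summand tau bv v.
Proof.
rewrite -(unvecK v); move: (size_unvec v); case: (unvec v) => // n1 w [wl].
have -> : F ^~ (vec l.+2 (n1 :: w)) = fun N =>
    qinv q (N%:Z - (sumn w)%:Z) *
    (qpoch q q (N - last n1 w) * qinv q (N%:Z - (last n1 w)%:Z - n1%:Z)) *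
    summand tau bv (vec l.+2 (n1 :: w)).
  by apply/funext => N; rewrite FE.
have Q0 := qpoch_inf_neq0 qlt1 qlt1.
have c1 : qinv q (N%:Z - (sumn w)%:Z) @[N --> \oo] --> (qpoch_inf q q)^-1.
  by apply: (qinv_cvg q0 qlt1 (K := sumn w)) => N; clear; lia.
have c2 : qinv q (N%:Z - (last n1 w)%:Z - n1%:Z) @[N --> \oo] -->
    (qpoch_inf q q)^-1.
  by apply: (qinv_cvg q0 qlt1 (K := (last n1 w + n1)%N)) => N; clear; lia.
have c3 : qpoch q q (N - last n1 w) @[N --> \oo] --> qpoch_inf q q.
  apply: (@cvg_shift _ _ _ (fun N => (N - last n1 w)%N) (last n1 w) _
    (@qpoch_cvg _ _ qlt1 q)) => N; clear; lia.
have -> : (qpoch_inf q q)^-1 * summand tau bv (vec l.+2 (n1 :: w)) =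
    (qpoch_inf q q)^-1 * (qpoch_inf q q * (qpoch_inf q q)^-1) *
    summand tau bv (vec l.+2 (n1 :: w)) by rewrite (mulfV Q0) mulr1.
exact: (cvgM (cvgM c1 (cvgM c3 c2)) (cvg_cst (summand tau bv (vec l.+2 (n1 :: w))))).
Qed.

(** Applied to [x = n_1 + n_r], the inequality [x^2 + 1 >= 2x] absorbs the negative term [-2 n_r] at
    the price of the constant 1; the square of [N_1] inside [word_exp] controls the other
    letters. *)
Let exponent_ge (n1 : nat) (w : seq nat) : size w = l.+1 ->
  exists Y : nat, exponent n1 w = (n1 + sumn w)%N%:Z + Y%:Z - 1.
Proof.
move=> wl; exists `|(exponent n1 w - (n1 + sumn w)%N%:Z + 1)%R|%N.
suff : 0 <= exponent n1 w - (n1 + sumn w)%N%:Z + 1 by clear; lia.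
have ws : (sumn w * sumn w <= word_exp t w)%N.
  by case: w wl => //= a w _; clear; nia.
have ls : (last n1 w <= sumn w)%N.
  by case: w wl {ws} => // a w _; apply: leq_sumn_mem; exact: (mem_last a w).
rewrite /exponent; move: (word_exp t w) (sumn w) (last n1 w) ws ls => W S L.
have SS : (S <= S * S)%N by case: (S) => // k; rewrite leq_pmulr.
have x2 : ((n1 + L).*2 <= (n1 + L) * (n1 + L) + 1)%N.
  by case: (n1 + L)%N => // k; have := leq_mul (leqnn k) (leqnn k); clear; lia.
rewrite -mulnn; move: ((n1 + L) * (n1 + L))%N x2 => X x2 WS LS.
by case: b; clear -SS x2 WS LS; lia.
Qed.

Let summand_bound : exists2 K : R, 0 <= K &
  forall v, `|summand tau bv v| <= (K * rho ^+ sumn (unvec v))%:C.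
Proof.
have [Q QP] := qinv_bound qlt1.
have Q0 : 0 <= Q by have := le_trans (normr_ge0 _) (QP 0); rewrite lecR.
have [Q' Q'P] := qpochV_bound q2lt1 q2lt1.
have Q'0 : 0 <= Q' by have := le_trans (normr_ge0 _) (Q'P 0%N); rewrite lecR.
(* [rho^-1] pays for the [- 1] in [exponent_ge], [Q] bounds each of the [l.+1] factors
   [1/(q;q)_(n_k)], and [Q'] bounds the factor with base [q^2]. *)
exists (rho^-1 * Q ^+ l.+1 * Q') => [|v].
  by case/andP: rho01 => rho0 _; rewrite !mulr_ge0 ?invr_ge0 ?exprn_ge0.
rewrite -{1}(unvecK v); move: (size_unvec v); case: (unvec v) => // n1 w [wl].
have hP : `|\prod_(x <- belast n1 w) qinv q x%:Z| <= (Q ^+ l.+1)%:C.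
  rewrite -wl -(size_belast n1 w); elim: (belast n1 w) => [|x s IH].
    by rewrite big_nil normr1 lexx.
  by rewrite big_cons [size _]/= (exprS Q) normrM rmorphM; apply: ler_pM.
have hX : `|p ^ exponent n1 w| <= (rho^-1 * rho ^+ sumn (n1 :: w))%:C.
  have [Y ->] := exponent_ge n1 wl.
  rewrite !expfzDr// !normrM exprN1 normfV mulrC rmorphM fmorphV rmorphXn /= -rhoE.
  rewrite ler_wpM2l ?invr_ge0// -!exprnP !normrX ler_piMr ?exprn_ge0//.
  by rewrite exprn_ile1// ltW.
have -> : rho^-1 * Q ^+ l.+1 * Q' * rho ^+ sumn (n1 :: w) =
  rho^-1 * rho ^+ sumn (n1 :: w) * Q ^+ l.+1 * Q' by ring.
rewrite summandE// !normrM normrX normrN1 expr1n (mul1r `|_|).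
rewrite (rmorphM _ (_ * _ * _)) (rmorphM _ (_ * _)).
apply: ler_pM; rewrite ?mulr_ge0 ?normr_ge0//.
by apply: ler_pM.
Qed.

Let F_bound : exists2 K : R, 0 <= K &
  forall N v, `|F N v| <= (K * rho ^+ sumn (unvec v))%:C.
Proof.
have [K K0 KP] := summand_bound.
have [Q QP] := qinv_bound qlt1.
have Q0 : 0 <= Q by have := le_trans (normr_ge0 _) (QP 0); rewrite lecR.
have [Q' Q'P] := qpoch_bound qlt1 q.
have Q'0 : 0 <= Q' by have := le_trans (normr_ge0 _) (Q'P 0%N); rewrite lecR.
exists (Q * (Q' * Q) * K) => [|N v]; first by rewrite !mulr_ge0.
rewrite -mulrA rmorphM; have := KP v; rewrite -{1 3}(unvecK v).
move: (size_unvec v); case E : (unvec v) => [|n1 w] // [wl] Kv.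
rewrite FE// normrM; apply: ler_pM => //.
rewrite !normrM (rmorphM _ Q) (rmorphM _ Q').
apply: ler_pM; rewrite ?mulr_ge0 ?normr_ge0//.
by apply: ler_pM.
Qed.

Lemma has_sum_summand (T : C) :
  chain q t (chain_base p b) l.+1 N @[N --> \oo] --> T ->
  has_sum (summand tau bv)
    (qpoch_inf q q * (T * qpoch_inf (- p ^+ (1 + b.*2)) q)).
Proof.
move=> LT; have [K K0 FK] := F_bound.
have L : chain q t (chain_base p b) l.+1 N * qpoch (- p ^+ (1 + b.*2)) q N
    @[N --> \oo] --> T * qpoch_inf (- p ^+ (1 + b.*2)) q.
  exact: (cvgM LT (@qpoch_cvg _ _ qlt1 (- p ^+ (1 + b.*2)))).
have H := dominated_has_sum (vec_geometric_bound K0 rho01) FK F_cvg F_sum L.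
refine (has_sum_eq (has_sumZ (c := qpoch_inf q q) H) _) => v.
by rewrite mulVKf// qpoch_inf_neq0.
Qed.

End Core.

Section Multisums.
Variable R : realType.
Local Notation C := R[i].
Variables (tau : C) (l : nat).
Hypothesis tau_gt0 : 0 < complex.Im tau.
Local Notation p := (qpow tau (1 / 2)).
Local Notation q := (p ^+ 2).
Let p0 : p != 0. Proof. exact: qpow_neq0. Qed.
Let p1 : `|p| < 1. Proof. exact: qpow_half_lt1. Qed.
Let qlt1 : `|q| < 1. Proof. by rewrite normrX exprn_ilt1. Qed.
Let q2lt1 : `|q ^+ 2| < 1. Proof. by rewrite normrX exprn_ilt1. Qed.

Let qpow_expn (x : rat) (n : nat) : x * 2 = n%:R -> qpow tau x = p ^+ n.
Proof. by move=> xn; rewrite -qpow_half -xn; congr qpow; field. Qed.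

Let qpow_halfB (m n : nat) : qpow tau ((m%:R - n%:R) / 2) = p ^ (m%:Z - n%:Z).
Proof.
have pn0 : p ^+ n != 0 by rewrite expf_neq0.
apply: (mulIf pn0); rewrite [in RHS]exprnP -expfzDr// subrK -exprnP.
by rewrite -!qpow_half -qpowD; congr qpow; field.
Qed.

Let denominator := qpochs_inf [:: p; p ^+ 3; q ^+ 2] (q ^+ 2).

Let ratioE : qpoch_inf (- p) q / qpoch_inf q q = denominator^-1.
Proof.
have := denominatorE p1; rewrite -/denominator.
have Q0 := qpoch_inf_neq0 qlt1 qlt1 => H.
have : denominator * qpoch_inf (- p) q != 0 by rewrite H.
rewrite mulf_eq0 negb_or => /andP[d0 m0].
by rewrite -H; field; rewrite d0 m0.
Qed.

Lemma has_sum_b0 :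
  has_sum (summand tau (b0vec l.+2)) (theta p (4 * l.+1 + 1) 1 / denominator).
Proof.
have expE n1 w : size w = l.+1 ->
    qpow tau (qexponent (b0vec l.+2) (vec l.+2 (n1 :: w))) =
    p ^ exponent l.+1 true n1 w.
  move=> wl; rewrite qexponent_b0// qpow_half exprnP /exponent mul0r subr0.
  by rewrite mul2n.
have H := has_sum_summand tau_gt0 expE (@chain_limit1 _ _ p0 p1 l.+1 isT).
have -> : theta p (4 * l.+1 + 1) 1 / denominator =
  qpoch_inf q q * ((1 + p) * (theta p (4 * l.+1 + 1) 1 *
    ((qpoch_inf q q)^-1 * (qpoch_inf q q)^-1)) * qpoch_inf (- p ^+ (1 + true.*2)) q).
  (* The factor [1 + p] left by the Bailey pair completes [(-p^3;q)_oo] to [(-p;q)_oo]. *)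
  have r1 := @qpoch_inf_rec _ (- p) q qlt1.
  rewrite -ratioE r1 opprK mulNr -exprS.
  have Q0 := qpoch_inf_neq0 qlt1 qlt1; field.
  exact: Q0.
exact: H.
Qed.

Lemma has_sum_b (j : nat) : (1 <= j <= l.+2)%N ->
  has_sum (summand tau (bvec l.+2 j)) (theta p (4 * l.+1 + 1) (2 * j) / denominator).
Proof.
move=> jl; have expE n1 w : size w = l.+1 ->
    qpow tau (qexponent (bvec l.+2 j) (vec l.+2 (n1 :: w))) =
    p ^ exponent (l.+2 - j) false n1 w.
  move=> wl; rewrite qexponent_b// /exponent mul0n addn0.
  by rewrite qpow_halfB -mul2n /=; congr (p ^ (_ - _)); clear; lia.
(* With [r = l.+2], there are [r - j] steps with [a = q] and [j - 1] with [a = 1]; for [j = r] the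
   switch comes before any step. *)
have E : (l.+2 - j + j.-1 = l.+1)%N by lia.
have L : chain q (l.+2 - j) (chain_base p false) l.+1 N @[N --> \oo] -->
    theta p (4 * l.+1 + 1) (2 * j) * ((qpoch_inf q q)^-1 * (qpoch_inf q q)^-1).
  have := @chain_limit0 _ _ p0 p1 (l.+2 - j) j.-1.
  rewrite E prednK; [exact|by lia].
have H := has_sum_summand tau_gt0 expE L.
have -> : theta p (4 * l.+1 + 1) (2 * j) / denominator =
  qpoch_inf q q * (theta p (4 * l.+1 + 1) (2 * j) *
    ((qpoch_inf q q)^-1 * (qpoch_inf q q)^-1) * qpoch_inf (- p ^+ (1 + false.*2)) q).
  rewrite -ratioE expr1.
  have Q0 := qpoch_inf_neq0 qlt1 qlt1; field.
  exact: Q0.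
exact: H.
Qed.

Lemma theta_qpow (D e : nat) (x y z : rat) : (e <= D)%N ->
  x * 2 = e%:R -> y * 2 = (D - e)%N%:R -> z * 2 = D%:R ->
  theta p D e / denominator =
  qpochs_inf [:: qpow tau x; qpow tau y; qpow tau z] (qpow tau z) /
  qpochs_inf [:: qpow tau (1 / 2); qpow tau (3 / 2); qpow tau 2] (qpow tau 2).
Proof.
move=> eD xe yD zD; rewrite (qpow_expn xe) (qpow_expn yD) (qpow_expn zD).
rewrite (@qpow_expn (3 / 2) 3); last by field.
have -> : qpow tau 2 = q ^+ 2 by rewrite -exprM; apply: qpow_expn.
by rewrite /theta /denominator.
Qed.

End Multisums.

Theorem theorem1p12 (R : realType) (tau : R[i]) (r : nat)
    (tau_gt0 : 0 < complex.Im tau) (r_ge2 : (2 <= r)%N) :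
  has_sum (summand tau (b0vec r))
    (qpochs_inf [:: qpow tau (1 / 2); qpow tau (2 * r%:R - 2);
                    qpow tau (2 * r%:R - 3 / 2)]
                (qpow tau (2 * r%:R - 3 / 2)) /
     qpochs_inf [:: qpow tau (1 / 2); qpow tau (3 / 2); qpow tau 2]
                (qpow tau 2))
  /\
  (forall j : nat, (1 <= j <= r)%N ->
   has_sum (summand tau (bvec r j))
    (qpochs_inf [:: qpow tau j%:R; qpow tau (2 * r%:R - j%:R - 3 / 2);
                    qpow tau (2 * r%:R - 3 / 2)]
                (qpow tau (2 * r%:R - 3 / 2)) /
     qpochs_inf [:: qpow tau (1 / 2); qpow tau (3 / 2); qpow tau 2]
                (qpow tau 2))).
Proof.
case: r r_ge2 => [|[|l]]// _.
have z2 : (2 * l.+2%:R - 3 / 2) * 2 = (4 * l.+1 + 1)%N%:R :> rat.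
  by rewrite natrD natrM -[l.+2%:R]natr1; field.
split=> [|j jl].
  have x1 : 1 / 2 * 2 = 1%:R :> rat by field.
  have y1 : (2 * l.+2%:R - 2) * 2 = (4 * l.+1 + 1 - 1)%N%:R :> rat.
    by rewrite addnK natrM -[l.+2%:R]natr1; ring.
  rewrite -(theta_qpow tau _ x1 y1 z2); last by rewrite addn1.
  exact: has_sum_b0.
have xj : j%:R * 2 = (2 * j)%N%:R :> rat by rewrite natrM mulrC.
have jD : (2 * j <= 4 * l.+1 + 1)%N by clear -jl; lia.
have yj : (2 * l.+2%:R - j%:R - 3 / 2) * 2 = (4 * l.+1 + 1 - 2 * j)%N%:R :> rat.
  by rewrite natrB// natrD !natrM -[l.+2%:R]natr1; field.
rewrite -(theta_qpow tau jD xj yj z2).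
exact: has_sum_b.
Qed.
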